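(* Let $A=(a_s)_{s\in S}\in(\mathbb{R}^d)^S$ be a finite vector configuration whose oriented matroid $\mathcal{M}(A)$ is acyclic, and let $(\mathcal{B},\mathcal{M}(A))$ be a (realizable) oriented building set. Then the acyclic nested complex of $(\mathcal{B},\mathcal{M}(A))$ is isomorphic to the boundary complex of the polar of the acyclonestohedron $\mathrm{Acyc}(\mathcal{B},A)$.
   Context: For $A=(a_s)_{s\in S}$, let $D(A)=\{\delta\in\mathbb{R}^S:\sum_s\delta_s a_s=0\}$ be the space of linear dependences and $D^*(A)=\{(f(a_s))_{s\in S}: f\in(\mathbb{R}^d)^*\}\subseteq\mathbb{R}^S$ the evaluation space. The signature of $\delta\in\mathbb{R}^S$ is the signed set $(\{s:\delta_s>0\},\{s:\delta_s<0\})$. The circuits of $A$ are the signatures $c=(c_+,c_-)$ of nonzero dependences of inclusion-minimal support $\underline{c}=c_+\cup c_-$. The oriented matroid $\mathcal{M}(A)$ is acyclic if $A$ has no nonzero dependence with all coefficients $\ge0$ (equivalently some linear form is positive on all $a_s$). A face of $\mathcal{M}(A)$ is a set $F\subseteq S$ for which some linear form $f$ satisfies $f(a_s)=0$ for $s\in F$ and $f(a_s)>0$ for $s\in S\setminus F$. A building set on $S$ is a set $\mathcal{B}$ of non-empty subsets of $S$ containing all singletons and such that $B,B'\in\mathcal{B}$ with $B\cap B'\neq\varnothing$ implies $B\cup B'\in\mathcal{B}$. $\kappa(\mathcal{B})$ is the set of inclusion-maximal elements of $\mathcal{B}$. A nested set on $\mathcal{B}$ is a subset $\mathcal{N}\subseteq\mathcal{B}$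 containing $\kappa(\mathcal{B})$ such that any two elements of $\mathcal{N}$ are nested or disjoint, and the union of any $k\ge2$ pairwise disjoint elements of $\mathcal{N}$ is not in $\mathcal{B}$. $(\mathcal{B},\mathcal{M}(A))$ is an oriented building set if $\underline{c}\in\mathcal{B}$ for every circuit $c$ of $A$. A nested set $\mathcal{N}$ is acyclic if $\bigcup\mathcal{N}'$ is a face of $\mathcal{M}(A)$ for every $\mathcal{N}'\subseteq\mathcal{N}$. The acyclic nested complex of $(\mathcal{B},\mathcal{M}(A))$ is the simplicial complex whose faces are the sets $\mathcal{N}\setminus\kappa(\mathcal{B})$ for all acyclic nested sets $\mathcal{N}$ on $\mathcal{B}$. Each circuit $c$ is the signature of a unique (up to positive rescaling) dependence $\delta$; set $r_c=\max_{s\in\underline{c}}|\delta_s|/\min_{s\in\underline{c}}|\delta_s|$. Let $R=|\mathcal{B}|\cdot\max_c r_c$, the maximum being over all circuits $c$ of $A$ (and taken to be $1$ if there is no circuit). Let $\rho\in\mathbb{R}^{\mathcal{B}}$ with $\rho_B=0$ if $|B|=1$ and $\rho_B=R^{|B|}$ if $|B|\ge2$. The nestohedron is the Minkowski sum $\mathrm{Nest}(\mathcal{B},\rho)=\sum_{B\in\mathcal{B}}\rho_B\triangle_B$, where $\triangle_B=\mathrm{conv}\{e_b:b\in B\}\subset\mathbb{R}^S$. The acyclonestohedron is $\mathrm{Acyc}(\mathcal{B},A)=\mathrm{Nest}(\mathcal{B},\rho)\cap D^*(A)$. The boundary complex of the polar of a polytope $Q$ is, as a poset, the set of non-empty faces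 of $Q$ ordered by reverse inclusion ($Q$ itself corresponding to the empty face). *)

(* Defs.v *)
From HB Require Import structures.
From mathcomp Require Import all_boot all_order all_algebra.
From mathcomp Require Import boolp classical_sets functions reals.

Set Implicit Arguments.
Unset Strict Implicit.
Unset Printing Implicit Defensive.

Import Order.TTheory GRing.Theory Num.Theory.

Local Open Scope classical_set_scope.
Local Open Scope ring_scope.

(* R^S as a left R-module; R^o is R seen as a module over itself. *)
Notation "''R^' ( R , S )" := {ffun S -> R^o}
  (at level 0, format "''R^' ( R ,  S )") : type_scope.

Section Posets.
Variables (T U : Type).

Definition poset_isomorphic (P : set T) (leT : T -> T -> Prop)
    (Q : set U) (leU : U -> U -> Prop) : Prop :=
  exists f : T -> U, set_bij P Q f /\
    (forall x y, P x -> P y -> leT x y <-> leU (f x) (f y)).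

End Posets.

Section Polytopes.
Variables (R : realType) (V : lmodType R).

Definition conv (X : set V) : set V :=
  [set x | exists (n : nat) (w : 'I_n -> R) (p : 'I_n -> V),
     [/\ forall i, 0 <= w i, \sum_i w i = 1, forall i, X (p i) &
         x = \sum_i w i *: p i]].

Definition minkowski_sum (I : finType) (P : {set I}) (X : I -> set V) : set V :=
  [set \sum_(i in P) x i | x in [set x : I -> V | forall i, i \in P -> X i (x i)]].

(* The maximizers over Q of a linear form; Q itself is obtained from the zero
   form. *)
Definition nonempty_face (Q : set V) : set (set V) :=
  [set F | F !=set0 /\ exists g : {scalar V},
     F = [set x | Q x /\ forall y, Q y -> g y <= g x]].

Definition polar_le (F G : set V) : Prop := G `<=` F.

End Polytopes.

Section VectorConfigurations.
Variables (R : realType) (d : nat) (S : finType) (A : S -> 'rV[R]_d).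

Definition dependences : set 'R^(R, S) :=
  [set delta | \sum_s delta s *: A s = 0].

Definition evaluations : set 'R^(R, S) :=
  [set [ffun s => f (A s)] | f in [set: {scalar 'rV[R]_d}]].

Definition signature (delta : 'R^(R, S)) : {set S} * {set S} :=
  ([set s | 0 < delta s]%SET, [set s | delta s < 0]%SET).

Definition sgsupp (c : {set S} * {set S}) : {set S} := c.1 :|: c.2.

Definition circuit (c : {set S} * {set S}) : Prop :=
  exists delta, [/\ dependences delta, delta != 0, signature delta = c &
    forall delta', dependences delta' -> delta' != 0 ->
      sgsupp (signature delta') \subset sgsupp c ->
      sgsupp (signature delta') = sgsupp c].

Definition acyclic_configuration : Prop :=
  forall delta, dependences delta -> (forall s, 0 <= delta s) -> delta = 0.

Definition matroid_face (F : {set S}) : Prop :=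
  exists f : {scalar 'rV[R]_d},
    (forall s, s \in F -> f (A s) = 0) /\ (forall s, s \notin F -> 0 < f (A s)).

(* The minimum is started from the maximum, which does not change its value. *)
Definition coef_ratio (delta : 'R^(R, S)) (C : {set S}) : R :=
  let M := \big[Num.max/0]_(s in C) `|delta s| in
  M / \big[Num.min/M]_(s in C) `|delta s|.

(* The dependence with signature c chosen by xget is unique up to a positive
   factor when c is a circuit, so the ratio does not depend on the choice. *)
Definition circuit_ratio (c : {set S} * {set S}) : R :=
  coef_ratio
    (xget 0 [set delta | dependences delta /\ signature delta = c]) (sgsupp c).

(* Ratios of circuits are at least 1, so that 1 only matters if there is no
   circuit. *)
Definition max_circuit_ratio : R :=
  \big[Num.max/1]_(c : {set S} * {set S} | `[< circuit c >]) circuit_ratio c.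

End VectorConfigurations.

Section BuildingSets.
Variable S : finType.
Implicit Types BB N : {set {set S}}.

Definition building_set BB : Prop :=
  [/\ forall B, B \in BB -> B != finset.set0,
      forall s, [set s]%SET \in BB &
      forall B B', B \in BB -> B' \in BB ->
        B :&: B' != finset.set0 -> B :|: B' \in BB].

Definition kappa BB : {set {set S}} :=
  [set B | maxset (fun B' => B' \in BB) B]%SET.

Definition nested_set BB N : Prop :=
  [/\ N \subset BB,
      kappa BB \subset N,
      forall B B', B \in N -> B' \in N ->
        [\/ B \subset B', B' \subset B | [disjoint B & B']%B] &
      forall K : {set {set S}}, K \subset N -> (2 <= #|K|)%N -> finset.trivIset K ->
        finset.cover K \notin BB].

End BuildingSets.

Section Acyclonestohedra.
Variables (R : realType) (d : nat) (S : finType).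
Implicit Types (BB N : {set {set S}}) (A : S -> 'rV[R]_d).

Definition oriented_building_set BB A : Prop :=
  building_set BB /\ forall c, circuit A c -> sgsupp c \in BB.

Definition acyclic_nested_set BB A N : Prop :=
  nested_set BB N /\
  forall N' : {set {set S}}, N' \subset N -> matroid_face A (finset.cover N').

Definition acyclic_nested_complex BB A : set {set {set S}} :=
  [set N :\: kappa BB | N in [set N | acyclic_nested_set BB A N]].

Definition basis_vec (b : S) : 'R^(R, S) := [ffun s => (s == b)%:R].

Definition simplex (B : {set S}) : set 'R^(R, S) :=
  conv [set basis_vec b | b in [set b | b \in B]].

Definition nestohedron BB (rho : {set S} -> R) : set 'R^(R, S) :=
  minkowski_sum BB (fun B => [set rho B *: x | x in simplex B]).

Definition rho_acyc BB A (B : {set S}) : R :=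
  if (2 <= #|B|)%N then (#|BB|%:R * max_circuit_ratio A) ^+ #|B| else 0.

Definition acyclonestohedron BB A : set 'R^(R, S) :=
  nestohedron BB (rho_acyc BB A) `&` evaluations A.

End Acyclonestohedra.

(* Main.v *)
From HB Require Import structures.
Require Import Defs.
From mathcomp Require Import all_boot all_order all_algebra.
From mathcomp Require Import boolp classical_sets functions reals.
From mathcomp Require Import ring lra fintype finset.

Set Implicit Arguments.
Unset Strict Implicit.
Unset Printing Implicit Defensive.

Import Order.TTheory GRing.Theory Num.Theory.

(** Write [mass x B] for the sum of the coordinates of [x] in [B], and [z B] for
    the sum of [rho B'] over the blocks [B'] included in [B]. The nestohedron is
    described by the inequalities [z B <= mass x B] for all blocks [B], with
    equality for the maximal blocks ([nestohedronP]). Hence a point [x] of the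
    acyclonestohedron has a tight set, the set of blocks at which equality holds,
    and the theorem amounts to saying that the tight sets are exactly the acyclic
    nested sets. Indeed a nonempty face is then the set of points at which the
    blocks of some acyclic nested set are tight, and this set can be recovered
    as the tight set of a point in the relative interior ([face_of_nested],
    [face_is_face_of], [face_of_subset]).

    Tight sets are acyclic nested sets ([tight_acyclic]) because [z] grows so
    fast: its value at a nonsingleton block exceeds [1 + r] times its total over
    any disjoint family of blocks strictly inside it, where [r] is the maximal
    circuit ratio ([steep], [rho_acyc_steep]). If a union
    of tight blocks were not a face, some circuit would have all its negative
    elements in this union and some positive element outside
    ([crossing_circuit]). The support of the circuit being a block, its union
    with the tight blocks that it meets is a block too; this block needs a large
    mass outside of the tight ones, which the dependence cannot balance.

    For the converse, an acyclic nested set [N] provides, for each [B] in [N], a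
    linear form vanishing on the union of the members of [N] that do not contain
    [B] and positive elsewhere. These forms make the equations [mass x B = w B],
    for [B] in [N], a triangular system on the evaluation space
    ([independent_masses]). Combining them with rapidly growing coefficients
    gives a point with tight set containing [N], not for [z] but for some other
    steep function ([tight_start]). Steepness is a convex condition, so it holds
    along the segment from this function to [z]. On the way, the tight sets
    remain acyclic nested sets by the first part, hence their equations remain
    solvable, and the point can be carried along ([tight_transport]). That the
    process does not stop before [z] is a question of attaining the maximum of a
    linear program, which is settled by counting active sets ([lp_attained]).
    The same principle yields the inequality description of the nestohedron
    ([block_decomposition]). *)

(** * Linear inequalities over an ordered field *)

Section LinearProgramming.
Local Open Scope ring_scope.
Variable R : realFieldType.

Lemma small_step (I : finType) (P : pred I) (a b : I -> R) :
  (forall i, P i -> 0 < a i) ->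
  exists2 e, 0 < e & forall i, P i -> 0 < a i + e * b i.
Proof.
move=> a_gt0.
pose q := 1 + \sum_(i | P i) `|b i| / a i.
have q_ge i : P i -> `|b i| / a i < q.
  move=> Pi; rewrite /q (bigD1 i) //=.
  have : 0 <= \sum_(j | P j && (j != i)) `|b j| / a j.
    by apply: sumr_ge0 => j /andP[/a_gt0 aj _]; rewrite divr_ge0 // ltW.
  lra.
have q_gt0 : 0 < q.
  have : 0 <= \sum_(j | P j) `|b j| / a j.
    by apply: sumr_ge0 => j /a_gt0 aj; rewrite divr_ge0 // ltW.
  rewrite /q; lra.
exists q^-1; first by rewrite invr_gt0.
move=> i Pi; have := q_ge i Pi; have ai := a_gt0 i Pi.
rewrite ltr_pdivrMr // mulrC => lt_b.
have : `|b i| * q^-1 < a i by rewrite ltr_pdivrMr // [_ * q]mulrC mulrC.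
have := ler_norm (- b i); rewrite normrN => le_b.
have : q^-1 * (- b i) <= q^-1 * `|b i| by rewrite ler_wpM2l // invr_ge0 ltW.
rewrite mulrN [q^-1 * `|_|]mulrC; lra.
Qed.

(** Finiteness of the number of active sets replaces compactness. If some
    segment inside [E] keeps the tight constraints of a feasible point tight and
    increases [g], then following it must hit a new constraint, since [g] is
    bounded; so every feasible point is dominated by a basic one, at which no
    such segment exists. Two basic points with the same tight constraints have
    the same value, hence [g] takes finitely many values at basic points. Only
    the behaviour along lines matters, so [E] may be any affine subspace and the
    constraints any affine functions. *)
Lemma lp_attained (V : lmodType R) (E : V -> Prop) (I : finType)
    (l : I -> V -> R) (g : V -> R) (M : R) :
  (forall y y' t, E y -> E y' -> E (y + t *: (y' - y))) ->
  (forall i y y' t, l i (y + t *: (y' - y)) = l i y + t * (l i y' - l i y)) ->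
  (forall y y' t, g (y + t *: (y' - y)) = g y + t * (g y' - g y)) ->
  (exists y, E y /\ forall i, 0 <= l i y) ->
  (forall y, E y -> (forall i, 0 <= l i y) -> g y <= M) ->
  exists y, [/\ E y, forall i, 0 <= l i y &
    forall y', E y' -> (forall i, 0 <= l i y') -> g y' <= g y].
Proof.
move=> Eline lline gline [y0 [Ey0 ly0]] gM.
pose feas y := E y /\ forall i, 0 <= l i y.
pose tight y : {set I} := [set i | l i y == 0]%SET.
pose basic y := feas y /\
  forall y', E y' -> (forall i, i \in tight y -> l i y' = 0) -> g y' = g y.
have to_basic y : feas y -> exists2 y', basic y' & g y <= g y'.
  have [n] := ubnP #|~: tight y|; elim: n => // n IHn in y *.
  rewrite ltnS => card_y fy; have [Ey ly] := fy.
  have [by_|] := pselect (basic y); first by exists y.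
  move=> nby; have {nby}[w [Ew lw gw]] :
      exists w, [/\ E w, forall i, i \in tight y -> l i w = 0 & g y < g w].
    apply: contrapT => now; apply: nby; split=> // w Ew lw.
    have [gt_w|lt_w|//] := ltgtP (g w) (g y).
    - case: now; exists (y + (-1) *: (w - y)); split.
      + exact: Eline.
      + move=> i iy; rewrite lline lw //.
        by move: iy; rewrite inE => /eqP ->; rewrite subr0 mulr0 addr0.
      + rewrite gline; lra.
    - by case: now; exists w.
  (* if no constraint decreases towards w, the ray through w is feasible *)
  have [all_ge|] := pselect (forall i, l i y <= l i w).
    pose t := 1 + (M - g y) / (g w - g y).
    have dg : 0 < g w - g y by lra.
    have t_ge0 : 0 <= t.
      have : 0 <= (M - g y) / (g w - g y).
        by rewrite divr_ge0 ?(ltW dg) // subr_ge0 gM.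
      rewrite /t; lra.
    have := gM (y + t *: (w - y)) (Eline _ _ _ Ey Ew) _.
    have -> : g (y + t *: (w - y)) = g w + (M - g y).
      by rewrite gline /t; field; rewrite gt_eqF.
    move=> H.
    have /H : forall i, 0 <= l i (y + t *: (w - y)).
      move=> i; rewrite lline addr_ge0 // mulr_ge0 // subr_ge0 //.
    lra.
  move=> /existsNP[i0 /negP]; rewrite -ltNge => li0.
  (* the first constraint met on the ray from y through w *)
  pose F i := l i y / (l i y - l i w).
  case: (@arg_minP _ _ _ i0 (fun i => l i w < l i y) F li0) => j lj jmin.
  pose t := F j.
  have t_ge0 : 0 <= t by rewrite divr_ge0 // subr_ge0 ltW.
  pose y1 := y + t *: (w - y).
  have fy1 : feas y1.
    split; first exact: Eline.
    move=> i; rewrite lline; have [li|li] := leP (l i y) (l i w).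
      by rewrite addr_ge0 // mulr_ge0 // subr_ge0.
    have := jmin i li; rewrite -/t /F ler_pdivlMr ?subr_gt0 // => ?; nra.
  have ly1 : l j y1 = 0.
    rewrite lline /t /F; field; rewrite subr_eq0 gt_eqF //.
  have jy : j \notin tight y.
    by apply/negP => jy; have := lw j jy; move: jy lj; rewrite inE => /eqP->; lra.
  have sub : tight y \proper tight y1.
    apply/properP; split.
      apply/subsetP => i iy; rewrite inE lline lw //.
      by move: iy; rewrite inE => /eqP ->; rewrite subr0 mulr0 addr0.
    by exists j => //; rewrite inE ly1.
  have [|y2 by2 gy2] := IHn y1 _ fy1.
    apply: leq_trans card_y; rewrite proper_card //.
    by rewrite properEneq setCS proper_sub // (inj_eq (@setC_inj _)) eq_sym
      proper_neq.
  exists y2 => //; apply: le_trans gy2; rewrite gline ler_wpDr //.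
  by rewrite mulr_ge0 // subr_ge0 ltW.
pose has_basic (J : {set I}) := `[< exists y, basic y /\ tight y = J >].
have [y1 by1 _] := to_basic y0 (conj Ey0 ly0).
pose G J := g (xget 0 [set y | basic y /\ tight y = J]).
have hb1 : has_basic (tight y1) by apply/asboolP; exists y1.
have Gbasic y : basic y -> G (tight y) = g y.
  move=> by_; rewrite /G.
  have := @xgetPex _ 0 [set y' | basic y' /\ tight y' = tight y]
    (ex_intro _ y (conj by_ erefl)).
  set y' := xget _ _ => -[[[Ey' _] _] ty'].
  case: by_ => [_ H]; apply: H => // i; rewrite -ty' inE.
  by move=> /eqP.
case: (@arg_maxP _ _ _ (tight y1) has_basic G hb1) => J /asboolP[y [by_ tyJ]] Jmax.
have [fy _] := by_; exists y; split; [exact: fy.1|exact: fy.2|].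
move=> y' Ey' ly'; have [y2 by2] := to_basic y' (conj Ey' ly').
move=> /le_trans; apply; rewrite -(Gbasic y) // tyJ -Gbasic //.
by apply: Jmax; apply/asboolP; exists y2.
Qed.

(** Gordan's alternative, by induction on [T]. Let [w] be positive on all vectors
    of [T] but [v b]. A zero value at [v b] is repaired by tilting [w], unless
    [v b] itself is zero and hence dependent. If the value is negative, project
    the other vectors along [v b] to the kernel of [w] and apply the induction
    hypothesis there. This gives either a form that can be corrected to vanish
    at [v b] and then tilted by a small multiple of [- w], or a nonnegative
    dependence to which [v b] is added with a nonnegative coefficient. *)
Lemma gordan (d : nat) (S : finType) (v : S -> 'rV[R]_d) (T : {set S}) :
  (exists w : 'cV[R]_d, forall s, s \in T -> 0 < (v s *m w) 0 0) \/
  (exists la : S -> R, [/\ forall s, 0 <= la s, forall s, s \notin T -> la s = 0,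
     exists2 s, s \in T & 0 < la s & \sum_s la s *: v s = 0]).
Proof.
have [n] := ubnP #|T|; elim: n => // n IHn in v T *; rewrite ltnS => cT.
have [->|[b bT]] := set_0Vmem T; first by left; exists 0 => s; rewrite inE.
have cT' : (#|T :\ b| < n)%N by rewrite (cardsD1 b T) bT in cT.
have [[w wP]|[la [la0 laT [s sT las] sum0]]] := IHn v (T :\ b) cT'; last first.
  right; exists la; split=> //.
    by move=> s' s'T; apply: laT; rewrite !inE (negPf s'T) andbF.
  by exists s => //; move: sT; rewrite !inE => /andP[].
pose f (u : 'rV[R]_d) := (u *m w) 0 0; have fb s : (v s *m w) 0 0 = f (v s) by [].
have fD u1 u2 : f (u1 + u2) = f u1 + f u2 by rewrite /f mulmxDl mxE.
have fZ k u : f (k *: u) = k * f u by rewrite /f -scalemxAl mxE.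
have [fb_pos|fb_neg|fb0] := ltgtP 0 (f (v b)).
- left; exists w => s sT; have [->//|ns] := eqVneq s b.
  by apply: wP; rewrite !inE ns.
- pose v' s := v s - (f (v s) / f (v b)) *: v b.
  have [[w' w'P]|[la [la0 laT [s0 s0T las] sum0]]] := IHn v' (T :\ b) cT'.
    pose g (u : 'rV[R]_d) := (u *m w') 0 0.
    have [e e0 eP] := @small_step S [in T :\ b] (fun s => g (v' s))
      (fun s => - f (v s)) w'P.
    left; exists (w' - (g (v b) / f (v b)) *: w - e *: w) => s sT.
    have -> : (v s *m (w' - (g (v b) / f (v b)) *: w - e *: w)) 0 0 =
       g (v s) - g (v b) / f (v b) * f (v s) - e * f (v s).
      by rewrite /f /g !mulmxBr -!scalemxAr !mxE.
    have [->|ns] := eqVneq s b.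
      rewrite divfK ?lt_eqF // subrr sub0r -mulrN mulr_gt0 //; lra.
    have := eP s; rewrite !inE ns sT => /(_ isT).
    have -> : g (v' s) = g (v s) - f (v s) / f (v b) * g (v b).
      rewrite /g mulmxBl -scalemxAl; move: (v s *m w') (v b *m w') => P Q.
      by rewrite !mxE.
    by congr (0 < _); ring.
  pose c := - (\sum_(s in T :\ b) la s * f (v s)) / f (v b).
  have c_ge0 : 0 <= c.
    rewrite /c mulNr -mulrN mulr_ge0 //.
      by apply: sumr_ge0 => s sT; rewrite mulr_ge0 // ltW // wP.
    by rewrite oppr_ge0 invr_le0 ltW.
  have lab : la b = 0 by apply: laT; rewrite !inE eqxx.
  right; exists (fun s => if s == b then c else la s); split.
  + by move=> s; case: ifP.
  + move=> s sT; case: eqP => [sb|_]; first by rewrite sb bT in sT.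
    by apply: laT; rewrite !inE (negPf sT) andbF.
  + exists s0; first by move: s0T; rewrite !inE => /andP[].
    by move: s0T; rewrite !inE; case: eqP.
  rewrite (bigD1 b) //= eqxx.
  rewrite (eq_bigr (fun s => la s *: v s)); last by move=> s /negPf ->.
  move: sum0; rewrite (bigD1 b) //= lab scale0r add0r /v'.
  rewrite (eq_bigr (fun s => la s *: v s - (la s * f (v s) / f (v b)) *: v b));
    last by move=> s _; rewrite scalerBr scalerA mulrA.
  rewrite sumrB -scaler_suml => /eqP; rewrite subr_eq0 => /eqP ->.
  rewrite -mulr_suml /c -scalerDl.
  have -> : \sum_(s in T :\ b) la s * f (v s) = \sum_(s | s != b) la s * f (v s).
    rewrite big_mkcond [RHS]big_mkcond; apply: eq_bigr => s _.
    rewrite !inE; case: (s == b) => //=; case: ifP => // /negbT sT.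
    by rewrite laT ?mul0r // !inE (negPf sT) andbF.
  by rewrite mulNr addNr scale0r.
have [vb0|vb_neq0] := eqVneq (v b) 0.
  right; exists (fun s => (s == b)%:R); split.
  - by move=> s; rewrite ler0n.
  - by move=> s sT; case: eqP => // sb; rewrite sb bT in sT.
  - by exists b => //; rewrite eqxx ltr01.
  rewrite (bigD1 b) //= eqxx vb0 scaler0 add0r big1 // => s /negPf ->.
  by rewrite scale0r.
have vv : 0 < (v b *m (v b)^T) 0 0.
  rewrite mxE lt_def sumr_ge0 ?andbT; last by move=> j _; rewrite mxE -expr2 sqr_ge0.
  apply: contra vb_neq0 => /eqP /psumr_eq0P H; apply/eqP/rowP => j.
  have := H (fun j _ => _) j; rewrite !mxE => /(_ _ isT) /eqP.
  rewrite mulf_eq0 orbb => H2; apply/eqP; apply: H2 => i.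
  by rewrite mxE -expr2 sqr_ge0.
have [e e0 eP] := @small_step S [in T :\ b] (fun s => f (v s))
      (fun s => (v s *m (v b)^T) 0 0) wP.
left; exists (w + e *: (v b)^T) => s sT.
have -> : (v s *m (w + e *: (v b)^T)) 0 0 = f (v s) + e * (v s *m (v b)^T) 0 0.
  rewrite /f mulmxDr -scalemxAr; move: (v s *m w) (v s *m (v b)^T) => P Q.
  by rewrite !mxE.
have [->|ns] := eqVneq s b; first by rewrite -fb0 add0r mulr_gt0.
by apply: eP; rewrite !inE ns.
Qed.

End LinearProgramming.

(** * Building sets and nested sets *)

Section BuildingSetCombinatorics.
Variables (S : finType) (BB : {set {set S}}).
Hypothesis BB_building : building_set BB.
Implicit Types (B U : {set S}) (K N : {set {set S}}).

Lemma building_neq0 B : B \in BB -> B != set0.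
Proof. by case: BB_building => H _ _; apply: H. Qed.

Lemma building_set1 s : [set s] \in BB.
Proof. by case: BB_building. Qed.

Lemma building_setU B B' : B \in BB -> B' \in BB -> B :&: B' != set0 ->
  B :|: B' \in BB.
Proof. by case: BB_building => _ _; apply. Qed.

Lemma building_cover B K : B \in BB -> K \subset BB ->
  (forall B', B' \in K -> B :&: B' != set0) -> B :|: cover K \in BB.
Proof.
move=> BBB /subsetP KBB meet; rewrite /cover.
apply: (big_rec (fun U => B :|: U \in BB)) => [|B' U B'K IH]; first by rewrite setU0.
rewrite setUCA setUC building_setU ?(KBB _ B'K) //.
have /set0Pn[s] := meet _ B'K; rewrite inE => /andP[sB sB'].
by apply/set0Pn; exists s; rewrite !inE sB sB'.
Qed.

Definition laminar N := forall B B', B \in N -> B' \in N ->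
  [\/ B \subset B', B' \subset B | [disjoint B & B']%B].

(** The inclusion-maximal elements of a laminar family that meet [B] are
    disjoint and see everything that the family sees inside [B]; by
    [building_cover] they merge with [B] into one block. *)
Lemma laminar_hull N B : laminar N -> exists K,
  [/\ K \subset N, trivIset K, forall B', B' \in K -> B :&: B' != set0 &
      B :&: cover N \subset cover K].
Proof.
move=> lamN; exists [set B' | maxset (mem N) B' & B :&: B' != set0]; split.
- by apply/subsetP => B'; rewrite inE => /andP[/maxsetp].
- apply/trivIsetP => B1 B2; rewrite !inE => /andP[m1 _] /andP[m2 _] n12.
  case: (lamN B1 B2 (maxsetp m1) (maxsetp m2)) => // sub.
    by move/maxsetsup: m1 => /(_ _ (maxsetp m2) sub) e; rewrite e eqxx in n12.
  by move/maxsetsup: m2 => /(_ _ (maxsetp m1) sub) e; rewrite e eqxx in n12.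
- by move=> B'; rewrite inE => /andP[].
- apply/subsetP => s; rewrite inE => /andP[sB /bigcupP[B1 B1N sB1]].
  have [B2 m2 sub] := maxset_exists (P := mem N) B1N.
  have sB2 := subsetP sub _ sB1.
  apply/bigcupP; exists B2 => //; rewrite inE m2; apply/set0Pn; exists s.
  by rewrite inE sB sB2.
Qed.

(** Otherwise the maximal elements of [K] meeting [B] would be at least two
    disjoint elements of [N] whose union, which swallows [B], is a block. *)
Lemma nested_cover N K B : nested_set BB N -> K \subset N -> B \in BB ->
  B \subset cover K -> exists2 B', B' \in K & B \subset B'.
Proof.
case=> NBB _ lamN Ncover KN BBB BK.
have lamK : laminar K by move=> B1 B2 /(subsetP KN) H1 /(subsetP KN) H2; apply: lamN.
have [K' [K'K tK' meet hull]] := laminar_hull B lamK.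
have BK' : B \subset cover K'.
  by apply: subset_trans hull; rewrite subsetI subxx.
have cK' : cover K' \in BB.
  have := building_cover BBB _ meet; rewrite (setUidPr BK'); apply.
  exact: subset_trans K'K (subset_trans KN NBB).
have : (#|K'| < 2)%N.
  rewrite ltnNge; apply/negP => cardK'.
  by have := Ncover K' (subset_trans K'K KN) cardK' tK'; rewrite cK'.
have [s sB] := set0Pn _ (building_neq0 BBB).
have /bigcupP[B' B'K' _] := subsetP BK' _ sB.
rewrite ltnS => card1; exists B'; first exact: (subsetP K'K).
have K'1 : K' = [set B'].
  by apply/eqP; rewrite eq_sym eqEcard sub1set B'K' cards1.
by move: BK'; rewrite K'1 cover1.
Qed.

(** By [nested_cover], the members of [N] that do not contain [B] do not cover
    [B]. For [B] in [N] this means that its children in [N] leave an element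
    free, which makes the systems of equations below triangular. *)
Lemma nested_core N B : nested_set BB N -> B \in BB ->
  exists2 s, s \in B & forall B', B' \in N -> s \in B' -> B \subset B'.
Proof.
move=> nestN BBB; pose K := [set B' in N | ~~ (B \subset B')].
have KN : K \subset N by apply/subsetP => B'; rewrite inE => /andP[].
have /subsetPn[s sB sK] : ~~ (B \subset cover K).
  apply/negP => /(nested_cover nestN KN BBB) [B'].
  by rewrite inE => /andP[_ /negP].
exists s => // B' B'N sB'; apply: contraR sK => nsub.
by apply/bigcupP; exists B' => //; rewrite inE B'N.
Qed.

(** The connected components of the restriction of the building set to [U]. *)
Definition blocks U : {set {set S}} :=
  [set B | maxset [pred B | (B \in BB) && (B \subset U)] B].

Lemma blocks_setT : blocks setT = kappa BB.
Proof.
apply/setP => B; rewrite !inE; apply: maxset_eq => B' /=.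
by rewrite subsetT andbT.
Qed.

Lemma blocksP U B : B \in blocks U -> (B \in BB) /\ (B \subset U).
Proof. by rewrite inE => /maxsetp /andP[]. Qed.

Lemma blocks_max U B : B \in BB -> B \subset U ->
  exists2 B', B' \in blocks U & B \subset B'.
Proof.
move=> BBB BU; have [|B' mB' sub] := maxset_exists
  (P := [pred B | (B \in BB) && (B \subset U)]) (C := B).
  by rewrite inE BBB.
by exists B' => //; rewrite inE.
Qed.

Lemma trivIset_blocks U : trivIset (blocks U).
Proof.
apply/trivIsetP => B1 B2 b1 b2; apply: contraNT; rewrite -setI_eq0 => meet.
have [B1B B1U] := blocksP b1; have [B2B B2U] := blocksP b2.
have P12 : [pred B | (B \in BB) && (B \subset U)] (B1 :|: B2).
  by rewrite inE building_setU // subUset B1U.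
move: b1 b2; rewrite !inE => b1 b2; apply/eqP.
rewrite -[LHS](maxsetsup b1 P12 (subsetUl _ _)).
exact: maxsetsup b2 P12 (subsetUr _ _).
Qed.

Lemma cover_blocks U : cover (blocks U) = U.
Proof.
apply/eqP; rewrite eqEsubset; apply/andP; split.
  by apply/bigcupsP => B /blocksP[].
apply/subsetP => s sU; have [|B bB sB] := blocks_max (building_set1 s) (U := U).
  by rewrite sub1set.
by apply/bigcupP; exists B => //; rewrite sub1set in sB.
Qed.

Lemma nested_smallest N s : nested_set BB N ->
  exists B, [/\ B \in N, s \in B & forall B', B' \in N -> s \in B' -> B \subset B'].
Proof.
case=> NBB kN lamN _.
have /bigcupP[B0 B0k sB0] : s \in cover (blocks setT) by rewrite cover_blocks inE.
rewrite blocks_setT in B0k; have B0N := subsetP kN _ B0k.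
pose P := [pred B in N | s \in B].
have PB0 : P B0 by rewrite /P /= B0N.
case: (arg_minnP (fun B : {set S} => #|B|) PB0) => B /andP[/= BN sB] minB.
exists B; split=> // B' B'N sB'; case: (lamN B B') => // [sub|/pred0P /(_ s)] /=.
  have /eqP-> // : B' == B; rewrite eqEcard sub minB //.
  by rewrite /P /= B'N.
by rewrite sB sB'.
Qed.

Variables (R : numDomainType) (rho : {set S} -> R).
Hypothesis rho_ge0 : forall B, B \in BB -> (0 <= rho B)%R.

(** The minimum over the Minkowski sum of the scaled simplices of the sum of the
    coordinates in [U]: a simplex contributes its scaling factor if it lies on
    [U], and nothing otherwise. *)
Definition weight U : R := (\sum_(B in BB | B \subset U) rho B)%R.

(** A block is nonempty, so it is counted in the weight of at most one of several
    disjoint sets. *)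
Lemma sum_weight_trivIset K (Q : pred {set S}) : trivIset K ->
  (forall B B', B \in K -> B' \in BB -> B' \subset B -> Q B') ->
  (\sum_(B in K) weight B <= \sum_(B in BB | Q B) rho B)%R.
Proof.
move=> /trivIsetP tK KQ; rewrite /weight.
rewrite (exchange_big_dep [pred B | (B \in BB) && Q B]) /=; last first.
  by move=> B B' BK /andP[B'B sub]; rewrite B'B (KQ B).
apply: ler_sum => B' /andP[B'B QB'].
have [/exists_inP[B0 B0K sub0]|/exists_inPn none] :=
    boolP [exists B0 in K, B' \subset B0].
  rewrite (big_pred1 B0) // => B /=; rewrite B'B /=.
  apply/andP/eqP => [[BK sub]|-> //]; apply/eqP; apply: contraT => nB.
  have [s sB'] := set0Pn _ (building_neq0 B'B).
  have /pred0P/(_ s) := tK _ _ BK B0K nB.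
  by rewrite /= (subsetP sub _ sB') (subsetP sub0 _ sB').
rewrite big_pred0 ?rho_ge0 // => B; rewrite B'B /=.
by apply/negP => /andP[/none/negP].
Qed.

Lemma weight_blocks U : (weight U <= \sum_(B in blocks U) weight B)%R.
Proof.
rewrite /weight (exchange_big_dep (mem BB)) /=; last by move=> ? ? _ /andP[].
rewrite big_mkcondr; apply: ler_sum => B' B'B.
have ge0 (P : pred {set S}) : (0 <= \sum_(i | P i) rho B')%R.
  by apply: sumr_ge0 => ? _; apply: rho_ge0.
case: ifP => [sub|_]; last exact: ge0.
have [B Bb sB] := blocks_max B'B sub.
by rewrite (bigD1 B) /= ?Bb ?B'B // lerDl ge0.
Qed.

End BuildingSetCombinatorics.

(** * Faces of the oriented matroid and circuits *)

Section Configurations.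
Local Open Scope ring_scope.
Variables (R : realType) (d : nat) (S : finType) (A : S -> 'rV[R]_d).
Implicit Types (x y v delta : 'R^(R, S)) (F B : {set S}).

Definition coordinate_form (w : 'cV[R]_d) (u : 'rV[R]_d) : R := (u *m w) 0 0.

Lemma coordinate_form_is_linear w : scalar (coordinate_form w).
Proof.
move=> k u u'; rewrite /coordinate_form mulmxDl -scalemxAl.
by move: (u *m w) (u' *m w) => P Q; rewrite !mxE.
Qed.

HB.instance Definition _ w := GRing.isLinear.Build R 'rV[R]_d R *%R
  (coordinate_form w) (coordinate_form_is_linear w).

Lemma scalar_coordinate_form (f : {scalar 'rV[R]_d}) :
  exists w, forall u, f u = coordinate_form w u.
Proof.
exists (\col_i f (delta_mx 0 i)) => u.
rewrite [in LHS](row_sum_delta u) linear_sum /coordinate_form mxE.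
by apply: eq_bigr => i _; rewrite linearZ !mxE.
Qed.

Lemma evaluationsP x :
  evaluations A x <-> exists w, forall s, x s = coordinate_form w (A s).
Proof.
split=> [[f _ <-]|[w xw]].
  have [w fw] := scalar_coordinate_form f.
  by exists w => s; rewrite ffunE fw.
exists (coordinate_form w) => //; apply/ffunP => s; by rewrite ffunE xw.
Qed.

Lemma evaluations_lin x y (t : R) :
  evaluations A x -> evaluations A y -> evaluations A (x + t *: y).
Proof.
move=> /evaluationsP[w xw] /evaluationsP[w' yw]; apply/evaluationsP.
exists (w + t *: w') => s; rewrite !ffunE xw yw /coordinate_form.
rewrite mulmxDr -scalemxAr; move: (A s *m w) (A s *m w') => P Q.
by rewrite !mxE.
Qed.

Lemma evaluations_line x y (t : R) :
  evaluations A x -> evaluations A y -> evaluations A (x + t *: (y - x)).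
Proof.
move=> evx evy; apply: evaluations_lin => //.
by rewrite -scaleN1r; apply: evaluations_lin.
Qed.

Lemma evaluations0 : evaluations A 0.
Proof.
by apply/evaluationsP; exists 0 => s; rewrite ffunE /coordinate_form mulmx0 mxE.
Qed.

Lemma evaluations_sum (I : finType) (P : pred I) (y : I -> 'R^(R, S)) (t : I -> R) :
  (forall i, P i -> evaluations A (y i)) ->
  evaluations A (\sum_(i | P i) t i *: y i).
Proof.
move=> ev; apply: (big_rec (evaluations A)) => [|i x Pi evx].
  exact: evaluations0.
by rewrite addrC; apply: evaluations_lin => //; apply: ev.
Qed.

Lemma dependence_evaluation delta x : dependences A delta -> evaluations A x ->
  \sum_s (delta s : R) * x s = 0.
Proof.
rewrite /dependences /= => dep /evaluationsP[w xw].
have := congr1 (coordinate_form w) dep; rewrite linear_sum linear0; apply: etrans.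
by apply: eq_bigr => s _; rewrite linearZ xw.
Qed.

Lemma dependences_lin delta delta' (t : R) : dependences A delta ->
  dependences A delta' -> dependences A (delta + t *: delta').
Proof.
rewrite /dependences /= => dep dep'.
transitivity (\sum_s delta s *: A s + t *: \sum_s delta' s *: A s).
  rewrite scaler_sumr -big_split; apply: eq_bigr => s _ /=.
  by rewrite !ffunE scalerDl scalerA.
by rewrite dep dep' scaler0 addr0.
Qed.

Lemma matroid_face_evaluation F : matroid_face A F -> exists y,
  [/\ evaluations A y, forall s, s \in F -> y s = 0 &
      forall s, s \notin F -> 0 < (y s : R)].
Proof.
case=> f [f0 fpos]; exists [ffun s => f (A s)]; split.
- by exists f.
- by move=> s /f0; rewrite ffunE.
- by move=> s /fpos; rewrite ffunE.
Qed.

(** A dependence that obstructs [F] from being a face: a linear form vanishing on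
    [F] and positive off [F] would have positive total against it. *)
Definition crossing F delta := [/\ dependences A delta,
  forall s, s \notin F -> 0 <= (delta s : R) &
  exists2 s, s \notin F & 0 < (delta s : R)].

(** Gordan's alternative modulo the span of the vectors indexed by [F], a quotient
    realized by the cokernel of the matrix of these vectors. *)
Lemma not_face_crossing F : ~ matroid_face A F -> exists delta, crossing F delta.
Proof.
move=> nface.
pose MF : 'M[R]_(#|S|, d) :=
  \matrix_(i < #|S|) (if enum_val i \in F then A (enum_val i) else 0).
have [[w wP]|[la [la0 laF [s0 s0F las0] sum0]]] :=
    gordan (fun s => A s *m cokermx MF) (~: F).
  have formE s : coordinate_form (cokermx MF *m w) (A s) =
      (A s *m cokermx MF *m w) 0 0 by rewrite /coordinate_form mulmxA.
  case: nface; exists (coordinate_form (cokermx MF *m w)); split=> s sF;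
    rewrite [_ (A s)]formE.
    have /eqP : A s *m cokermx MF == 0.
      rewrite -submxE; apply/submxP; exists (delta_mx 0 (enum_rank s)).
      by rewrite -rowE rowK enum_rankK sF.
    by move=> ->; rewrite mul0mx mxE.
  by apply: wP; rewrite inE.
have : ((\sum_s la s *: A s)%R <= MF)%MS.
  rewrite submxE mulmx_suml; apply/eqP; rewrite -[RHS]sum0.
  by apply: eq_bigr => s _; rewrite scalemxAl.
case/submxP => u sumu.
exists [ffun s => if s \in F then - u 0 (enum_rank s) else la s]; split.
- rewrite /dependences /=.
  transitivity (\sum_s la s *: A s - u *m MF); last by rewrite sumu subrr.
  rewrite mulmx_sum_row (reindex (@enum_rank S)) /=; last first.
    by exists enum_val => ? _; rewrite ?enum_rankK ?enum_valK.
  rewrite -sumrB; apply: eq_bigr => s _; rewrite ffunE rowK enum_rankK.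
  case: ifP => sF; last by rewrite scaler0 subr0.
  by rewrite laF ?scale0r ?sub0r ?scaleNr // inE sF.
- by move=> s sF; rewrite ffunE (negPf sF).
- by rewrite inE in s0F; exists s0 => //; rewrite ffunE (negPf s0F).
Qed.

Lemma sgsuppE delta s : (s \in sgsupp (signature delta)) = (delta s != 0).
Proof. by rewrite !inE orbC -neq_lt. Qed.

(** A crossing dependence [delta] of minimal support is a circuit. Let [e] be a
    dependence of smaller support. If [e] is positive somewhere off [F],
    subtract the largest multiple of [e] that keeps [delta] nonnegative off
    [F]: either the difference or [e] itself is a smaller crossing dependence.
    Applied to [e] and [- e] this shows that [e] is supported on [F], and then a
    multiple of [e] can be used to remove an element of [F] from the support of
    [delta]. *)
Lemma crossing_circuit F : ~ matroid_face A F ->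
  exists2 delta, crossing F delta & circuit A (signature delta).
Proof.
move=> /not_face_crossing ex.
pose supp delta := sgsupp (signature delta).
pose P n := `[< exists delta, crossing F delta /\ #|supp delta| = n >].
have exP : exists n, P n.
  by case: ex => delta cr; exists #|supp delta|; apply/asboolP; exists delta.
case: (ex_minnP exP) => n /asboolP[delta [cr cardn]] minn.
exists delta => //; exists delta; have [dep ge0 [s0 s0F ds0]] := cr; split=> //.
  by apply: contraTneq ds0 => ->; rewrite ffunE ltxx.
move=> delta' dep' n0 sub.
apply/eqP; rewrite eqEproper sub /=; apply/negP => psub.
have no_smaller e : supp e \proper supp delta -> ~ crossing F e.
  move=> /proper_card + cre; rewrite cardn ltnNge minn //.
  by apply/asboolP; exists e.
have sub0 e s : supp e \proper supp delta -> delta s = 0 -> e s = 0.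
  move=> /proper_sub/subsetP/(_ s); rewrite !sgsuppE => H ds.
  by apply/eqP; apply: contraT => /H; rewrite ds eqxx.
have kill e (t : R) s : supp e \proper supp delta -> e s != 0 ->
    (delta s : R) + t * e s = 0 -> supp (delta + t *: e) \proper supp delta.
  move=> pe es es0; apply/properP; split.
    apply/subsetP => s'; rewrite !sgsuppE; apply: contra => /eqP d0.
    by rewrite !ffunE d0 (sub0 e) // scaler0 addr0.
  exists s; last by rewrite sgsuppE !ffunE [X in X != 0]es0 eqxx.
  by rewrite sgsuppE; apply: contra es => /eqP /(sub0 e) ->.
have no_pos e : dependences A e -> supp e \proper supp delta ->
    forall s, s \notin F -> (e s : R) <= 0.
  move=> depe pe s1 s1F; rewrite leNgt; apply/negP => es1.
  pose Q := [pred s | (s \notin F) && (0 < (e s : R))].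
  have Qs1 : Q s1 by rewrite /Q /= s1F.
  case: (@arg_minP _ _ _ s1 Q (fun s => (delta s : R) / e s) Qs1).
  move=> j /andP[jF ej] jmin.
  set t := (delta j : R) / e j in jmin.
  have t_ge0 : 0 <= t by rewrite divr_ge0 ?ge0 // ltW.
  pose e' := delta + (- t) *: e.
  have e's s : e' s = (delta s : R) - t * e s by rewrite /e' !ffunE scaleNr.
  have e'ge0 s : s \notin F -> 0 <= (e' s : R).
    move=> sF; rewrite e's subr_ge0; have [es|es] := ltP 0 (e s : R).
      by rewrite -ler_pdivlMr // jmin // /Q /= sF.
    by rewrite (le_trans _ (ge0 s sF)) // mulr_ge0_le0.
  have /no_smaller : supp e' \proper supp delta.
    apply: (kill e (- t) j) => //; first by rewrite gt_eqF.
    by rewrite mulNr divfK ?subrr // gt_eqF.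
  move=> nc; have eq_off s : s \notin F -> (delta s : R) = t * e s.
    move=> sF; apply/eqP; rewrite -subr_eq0 -e's eq_le e'ge0 // andbT leNgt.
    apply/negP => pos; apply: nc; split=> //; last by exists s.
    exact: dependences_lin.
  have t_gt0 : 0 < t.
    rewrite lt_def t_ge0 andbT; apply: contraTneq ds0 => t0.
    by rewrite eq_off // t0 mul0r ltxx.
  apply: (no_smaller e pe); split=> //; last by exists s1.
  by move=> s sF; rewrite -(pmulr_rge0 _ t_gt0) -eq_off // ge0.
have pd' : supp delta' \proper supp delta by [].
have d'0 s : s \notin F -> delta' s = 0.
  move=> sF; apply/eqP; rewrite eq_le no_pos //=.
  have d's : (0 + (-1) *: delta') s = - delta' s.
    by rewrite !ffunE scaleN1r add0r.
  rewrite -oppr_le0 -d's no_pos //.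
    by apply: dependences_lin => //; rewrite /dependences /= big1 // => ? _;
      rewrite ffunE scale0r.
  rewrite (_ : supp _ = supp delta') //; apply/setP => s'; rewrite !sgsuppE.
  by rewrite !ffunE scaleN1r add0r oppr_eq0.
have [s1 ds1] : exists s, delta' s != 0.
  apply: contrapT => none; case/eqP: n0; apply/ffunP => s.
  by rewrite ffunE; apply/eqP; apply: contraT => ns; case: none; exists s.
pose t : R := - (delta s1 : R) / delta' s1.
apply: (no_smaller (delta + t *: delta')).
  by apply: (kill _ _ s1) => //; rewrite /t divfK // subrr.
have off s : s \notin F -> (delta + t *: delta') s = delta s.
  by move=> sF; rewrite !ffunE d'0 // scaler0 addr0.
split; first exact: dependences_lin.
  by move=> s sF; rewrite off // ge0.
by exists s0 => //; rewrite off.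
Qed.

End Configurations.

(** * Tight sets are acyclic nested sets *)

Section Mass.
Local Open Scope ring_scope.
Variables (R : realType) (S : finType).
Implicit Types (x v : 'R^(R, S)) (B : {set S}).

Definition mass x B : R := \sum_(s in B) (x s : R).

Lemma massE x B : mass x B = \sum_s (if s \in B then x s : R else 0).
Proof. exact: big_mkcond. Qed.

Lemma massD x v (t : R) B : mass (x + t *: v) B = mass x B + t * mass v B.
Proof.
rewrite /mass mulr_sumr -big_split; apply: eq_bigr => s _ /=.
by rewrite !ffunE.
Qed.

Lemma massB x v B : mass (x - v) B = mass x B - mass v B.
Proof. by rewrite -scaleN1r massD mulN1r. Qed.

Lemma mass0 B : mass 0 B = 0.
Proof. by rewrite /mass big1 // => s _; rewrite ffunE. Qed.

Lemma mass1 x s : mass x [set s] = x s.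
Proof. by rewrite /mass big_set1. Qed.

Lemma mass_sum (I : finType) (P : pred I) (t : I -> R) (y : I -> 'R^(R, S)) B :
  mass (\sum_(i | P i) t i *: y i) B = \sum_(i | P i) t i * mass (y i) B.
Proof.
apply: (big_rec2 (fun x m => mass x B = m)) => [|i x m _ <-]; first exact: mass0.
by rewrite addrC massD addrC.
Qed.

Lemma mass_cover x K : trivIset K -> mass x (cover K) = \sum_(B in K) mass x B.
Proof. by move=> tK; rewrite /mass big_trivIset. Qed.

Lemma massUI x B B' : mass x (B :|: B') + mass x (B :&: B') = mass x B + mass x B'.
Proof.
rewrite !massE -!big_split; apply: eq_bigr => s _ /=.
rewrite !inE; case: (s \in B); case: (s \in B') => //=; last by rewrite addrC.
Qed.

Lemma mass_ge0 x B : (forall s, 0 <= (x s : R)) -> 0 <= mass x B.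
Proof. by move=> x0; apply: sumr_ge0. Qed.

Lemma mass_sub x B B' : (forall s, 0 <= (x s : R)) -> B \subset B' ->
  mass x B <= mass x B'.
Proof.
move=> x0 /subsetP sub; rewrite !massE.
apply: ler_sum => s _ /=; have [/sub ->//|_] := boolP (s \in B).
by case: ifP.
Qed.

End Mass.

Section TightSets.
Local Open Scope ring_scope.
Variables (R : realType) (d : nat) (S : finType) (A : S -> 'rV[R]_d).
Variable BB : {set {set S}}.
Hypothesis A_acyclic : acyclic_configuration A.
Hypothesis BB_oriented : oriented_building_set BB A.
Implicit Types (x v : 'R^(R, S)) (B C : {set S}) (K N : {set {set S}}).
Implicit Types z : {set S} -> R.

Let BB_building : building_set BB. Proof. by case: BB_oriented. Qed.
Let BB_neq0 := building_neq0 BB_building.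
Let BB_set1 := building_set1 BB_building.
Let BB_setU := building_setU BB_building.

(** The nestohedron cut by the evaluation space, in terms of inequalities indexed
    by the blocks; leaving [z] free allows the right hand sides to move. *)
Definition feasible z x := [/\ evaluations A x,
  forall B, B \in BB -> z B <= mass x B & forall B, B \in kappa BB -> mass x B = z B].

Definition tight z x : {set {set S}} := [set B in BB | mass x B == z B].

Local Notation r := (max_circuit_ratio A).

(** The growth condition on the right hand sides that the whole argument needs. It
    consists of linear inequalities in [z], so it holds along the segment
    between two functions that satisfy it. *)
Definition steep z := (forall s, z [set s] = 0) /\
  forall C K, C \in BB -> (2 <= #|C|)%N -> K \subset BB -> trivIset K ->
    (forall B, B \in K -> B \proper C) -> (1 + r) * (\sum_(B in K) z B) < z C.

Lemma max_circuit_ratio_ge1 : 1 <= r.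
Proof. exact: bigmax_ge_id. Qed.

(** The witness is the dependence selected in the definition of the ratio of the
    circuit. Crossing a set depends on the signature only, so it may replace any
    other dependence of this circuit. *)
Lemma circuit_spread c : circuit A c -> exists delta, exists2 m : R, 0 < m &
  [/\ dependences A delta, signature delta = c &
      forall s, s \in sgsupp c -> m <= `|delta s : R| <= r * m].
Proof.
move=> circ; have [delta0 [dep0 _ sg0 _]] := circ.
set P := [set delta | dependences A delta /\ signature delta = c]%classic.
have := @xgetPex _ 0 P (ex_intro _ delta0 (conj dep0 sg0)).
set delta := xget 0 P => -[dep sg].
pose C := sgsupp c.
pose M : R := \big[Num.max/0]_(s in C) `|delta s : R|.
pose m : R := \big[Num.min/M]_(s in C) `|delta s : R|.
have leM s : s \in C -> `|delta s : R| <= M.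
  by move=> sC; apply: (le_bigmax_cond 0 (fun s => `|delta s : R|)).
have gem s : s \in C -> m <= `|delta s : R|.
  by move=> sC; apply: (bigmin_le_cond M (fun s => `|delta s : R|)).
have pos s : s \in C -> 0 < `|delta s : R|.
  by rewrite /C -sg sgsuppE normr_gt0.
have [C0|[s0 s0C]] := set_0Vmem C.
  exists delta; exists 1; rewrite ?ltr01 //; split=> // s.
  by rewrite -/C C0 inE.
have M_gt0 : 0 < M by apply: lt_le_trans (pos s0 s0C) (leM s0 s0C).
have m_gt0 : 0 < m.
  by rewrite /m; apply: (big_rec (fun t => 0 < t)) => // s t sC t0;
    rewrite lt_min pos.
exists delta; exists m => //; split=> // s sC; rewrite gem //=.
apply: le_trans (leM s sC) _; rewrite -ler_pdivrMr //.
have -> : M / m = circuit_ratio A c by [].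
by apply: (le_bigmax_cond 1 (circuit_ratio A)); apply/asboolP.
Qed.

Lemma card_ge2_proper B C : B != set0 -> B \proper C -> (2 <= #|C|)%N.
Proof. by rewrite -card_gt0 => B0 /proper_card; apply: leq_trans. Qed.

Section Steep.
Variable z : {set S} -> R.
Hypothesis z_steep : steep z.

Lemma steep_gt0 B : B \in BB -> (2 <= #|B|)%N -> 0 < z B.
Proof.
move=> BBB B2; case: z_steep => _ /(_ B set0 BBB B2 (sub0set _)).
rewrite big_set0 mulr0; apply; last by move=> ?; rewrite inE.
by apply/trivIsetP => ? ?; rewrite inE.
Qed.

Lemma steep_ge0 B : B \in BB -> 0 <= z B.
Proof.
move=> BBB; have := BB_neq0 BBB; rewrite -card_gt0 leq_eqVlt eq_sym.
case/orP => [/cards1P[s ->]|B2]; first by case: z_steep => ->.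
exact: ltW (steep_gt0 BBB B2).
Qed.

Lemma steep_double B C : B \in BB -> C \in BB -> B \proper C -> 2 * z B < z C.
Proof.
move=> BBB CBB BC; have C2 := card_ge2_proper (BB_neq0 BBB) BC.
case: z_steep => _ /(_ C [set B] CBB C2); rewrite sub1set big_set1 => H.
apply: le_lt_trans (H BBB _ _); first by rewrite ler_wpM2r ?steep_ge0 //;
  have := max_circuit_ratio_ge1; lra.
  by apply/trivIsetP => B1 B2 /set1P-> /set1P->; rewrite eqxx.
by move=> B' /set1P ->.
Qed.

Lemma feasible_ge0 x : feasible z x -> forall s, 0 <= (x s : R).
Proof.
case=> _ ge _ s; rewrite -mass1 (le_trans _ (ge _ (BB_set1 s))) //.
by case: z_steep => ->.
Qed.

(** If two tight blocks overlapped, or several disjoint ones had a block as union,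
    then the mass of the union would be at most the sum of the right hand sides
    of the parts, against steepness. *)
Lemma tight_nested x : feasible z x -> nested_set BB (tight z x).
Proof.
move=> fx; have x0 := feasible_ge0 fx; have [ev ge kap] := fx.
have tightP B : B \in tight z x -> B \in BB /\ mass x B = z B.
  by rewrite inE => /andP[? /eqP].
split.
- by apply/subsetP => B /tightP[].
- apply/subsetP => B Bk; rewrite inE kap // eqxx andbT.
  by move: Bk; rewrite inE => /maxsetp.
- move=> B B' /tightP[BBB mB] /tightP[B'BB mB'].
  have [BB'|nBB'] := boolP (B \subset B'); first by constructor 1.
  have [B'B|nB'B] := boolP (B' \subset B); first by constructor 2.
  constructor 3; rewrite -setI_eq0; apply: contraT => meet.
  have CBB := BB_setU BBB B'BB meet.
  have p1 : B \proper B :|: B' by rewrite properE subsetUl subUset subxx.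
  have p2 : B' \proper B :|: B' by rewrite properE subsetUr subUset subxx andbT.
  have := steep_double BBB CBB p1; have := steep_double B'BB CBB p2.
  have := massUI x B B'; have := ge _ CBB.
  have := mass_ge0 (B :&: B') x0; lra.
- move=> K /subsetP KN K2 tK; apply/negP => CBB.
  have prop B : B \in K -> B \proper cover K.
    move=> BK; rewrite properE (bigcup_max B) //=; apply/negP => sub.
    have : (0 < #|K :\ B|)%N by move: K2; rewrite (cardsD1 B K) BK.
    rewrite card_gt0 => /set0Pn[B']; rewrite !inE => /andP[nB B'K].
    have /tightP[/BB_neq0/set0Pn[s sB'] _] := KN _ B'K.
    have sC : s \in cover K by apply/bigcupP; exists B'.
    move/trivIsetP: tK => /(_ _ _ B'K BK nB) /pred0P/(_ s).
    by rewrite /= sB' (subsetP sub).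
  have [B BK] : exists B, B \in K.
    by apply/set0Pn; rewrite -card_gt0; apply: leq_trans K2.
  have [BBB _] := tightP _ (KN _ BK).
  have C2 := card_ge2_proper (BB_neq0 BBB) (prop _ BK).
  have KBB : K \subset BB by apply/subsetP => B' /KN/tightP[].
  case: z_steep => _ /(_ _ _ CBB C2 KBB tK prop).
  have := ge _ CBB; rewrite mass_cover //.
  rewrite (eq_bigr z); last by move=> B' /KN/tightP[].
  have : 0 <= \sum_(B' in K) z B'.
    by apply: sumr_ge0 => B' B'K; apply/steep_ge0/(subsetP KBB).
  have := max_circuit_ratio_ge1; nra.
Qed.

(** Suppose that the union [F] of some tight blocks is not a face, and take a
    circuit crossing [F]. Let [K] consist of the maximal ones of these blocks
    that meet the support [c] of the circuit, and [C] be the union of [c] and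
    of [K], a block. The dependence annihilates [x]. Its coefficients on [F] are
    at least [- r * m] and those on [c] off [F] are at least [m], so the mass of
    [C] off [K] is at most [r] times that of [K]. The blocks in [K] are tight,
    hence [z C] is at most [1 + r] times the total of [z] over [K]. *)
Lemma tight_acyclic x : feasible z x -> acyclic_nested_set BB A (tight z x).
Proof.
move=> fx; have x0 := feasible_ge0 fx; have [ev ge kap] := fx.
have nestN := tight_nested fx; split=> // N' N'N; apply: contrapT => nface.
have [delta1 [_ ge1 [s1 s1F ds1]] circ] := crossing_circuit nface.
have [delta [m m0 [dep sg spread]]] := circuit_spread circ.
set F := cover N' in nface s1F ge1.
have sgn s : (0 < (delta s : R)) = (0 < (delta1 s : R)) /\
             (delta s < 0 :> R) = (delta1 s < 0 :> R).
  case: sg => /setP e1 /setP e2; split.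
    by have := e1 s; rewrite !inE.
  by have := e2 s; rewrite !inE.
have dge0 s : s \notin F -> 0 <= (delta s : R).
  by move=> /ge1; rewrite !leNgt; case: (sgn s) => _ ->.
have dpos : 0 < (delta s1 : R) by case: (sgn s1) => ->.
set c := sgsupp (signature delta) in spread *.
rewrite -sg -/c in spread.
have cBB : c \in BB by case: BB_oriented => _; rewrite /c sg; apply.
have NBB : tight z x \subset BB by case: nestN.
have lam : laminar N'.
  by case: nestN => _ _ lamN _ B B' /(subsetP N'N) H /(subsetP N'N); apply: lamN.
have [K [KN' tK meet hull]] := laminar_hull c lam.
have KN : K \subset tight z x := subset_trans KN' N'N.
have KBB : K \subset BB := subset_trans KN NBB.
pose C := c :|: cover K.
have CBB : C \in BB by apply: building_cover.
have KF : cover K \subset F.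
  by apply/bigcupsP => B BK; apply: (bigcup_max B) => //; apply: (subsetP KN').
have s1c : s1 \in c by rewrite sgsuppE gt_eqF.
have Kprop B : B \in K -> B \proper C.
  move=> BK; apply/properP; split.
    by apply/subsetP => s sB; rewrite inE; apply/orP; right; apply/bigcupP; exists B.
  exists s1; first by rewrite in_setU s1c.
  by apply: contra s1F => sB; apply: (subsetP KF); apply/bigcupP; exists B.
(* acyclicity of A gives the circuit a second element *)
have [s2 ds2] : exists s, (delta s : R) < 0.
  apply: contrapT => none; have d0 : delta = 0.
    by apply: A_acyclic => // s; rewrite leNgt; apply/negP => ?; apply: none; exists s.
  by move: dpos; rewrite d0 ffunE ltxx.
have C2 : (2 <= #|C|)%N.
  apply: (@card_ge2_proper [set s1]).
    by rewrite -card_gt0 cards1.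
  apply/properP; split; first by rewrite sub1set in_setU s1c.
  exists s2; first by rewrite in_setU sgsuppE lt_eqF.
  by rewrite inE; apply: contraTneq dpos => <-; rewrite -leNgt ltW.
have massK : mass x (cover K) = \sum_(B in K) z B.
  rewrite mass_cover //; apply: eq_bigr => B /(subsetP KN).
  by rewrite inE => /andP[_ /eqP].
have low : m * (mass x C - mass x (cover K)) <=
    \sum_(s | s \notin F) (delta s : R) * x s.
  have -> : mass x C - mass x (cover K) = \sum_(s in C :\: cover K) (x s : R).
    rewrite /mass (big_setID (cover K)) /= (setIidPr _) ?subsetUr //.
    have cancel_l (a b : R) : a + b - a = b by ring.
    exact: cancel_l.
  rewrite mulr_sumr big_mkcond [X in _ <= X]big_mkcond; apply: ler_sum => s _ /=.
  rewrite in_setD in_setU; case: (boolP (s \in cover K)) => /= sK.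
    by case: ifP => sF //; rewrite mulr_ge0 ?dge0 ?sF.
  rewrite orbF; case: ifP => sc; last by case: ifP => sF //; rewrite mulr_ge0 ?dge0 ?sF.
  have sF : s \notin F.
    apply: contra sK => sF; apply: (subsetP hull).
    by rewrite in_setI sc.
  rewrite sF ler_wpM2r //; have /andP[+ _] := spread s sc.
  by rewrite ger0_norm // dge0.
have upp : - (r * m * mass x (cover K)) <= \sum_(s in F) (delta s : R) * x s.
  rewrite /mass mulr_sumr -sumrN big_mkcond [X in _ <= X]big_mkcond.
  apply: ler_sum => s _; rewrite -mulNr.
  have r0 : 0 <= r by apply: le_trans max_circuit_ratio_ge1.
  case: (boolP (s \in cover K)) => sK.
    rewrite (subsetP KF _ sK) ler_wpM2r // lerNl.
    have [sc|/negbTE sc] := boolP (s \in c).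
      have /andP[_] := spread s sc; apply: le_trans.
      by rewrite -normrN ler_norm.
    move: sc; rewrite sgsuppE => /negbFE/eqP ->.
    by rewrite oppr0 mulr_ge0 // ltW.
  case: ifP => sF //; have : s \notin c.
    by apply: contra sK => sc; apply: (subsetP hull); rewrite in_setI sc.
  by rewrite sgsuppE negbK => /eqP ->; rewrite mul0r.
have := dependence_evaluation dep ev.
rewrite (bigID [in F]) /= => tot.
have {tot low upp} : mass x C <= (1 + r) * mass x (cover K).
  rewrite -(ler_pM2l m0); nra.
rewrite massK; case: z_steep => _ /(_ _ _ CBB C2 KBB tK Kprop).
have := ge _ CBB; lra.
Qed.

End Steep.
End TightSets.

(** * Every acyclic nested set is a tight set *)

Section Realization.
Local Open Scope ring_scope.
Variables (R : realType) (d : nat) (S : finType) (A : S -> 'rV[R]_d).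
Variable BB : {set {set S}}.
Hypothesis A_acyclic : acyclic_configuration A.
Hypothesis BB_oriented : oriented_building_set BB A.
Implicit Types (x v : 'R^(R, S)) (B C : {set S}) (K N : {set {set S}}).
Implicit Types z w : {set S} -> R.

Let BB_building : building_set BB. Proof. by case: BB_oriented. Qed.
Local Notation feasible := (feasible A BB).
Local Notation tight := (tight BB).
Local Notation steep := (steep A BB).
Local Notation r := (max_circuit_ratio A).

(** The form attached to [B] comes from the face that is the union of all elements
    of [N] not containing [B]. *)
Lemma nested_forms N : acyclic_nested_set BB A N ->
  exists y : {set S} -> 'R^(R, S), forall B,
  [/\ evaluations A (y B), forall s, 0 <= (y B s : R),
      forall s B', B' \in N -> s \in B' -> ~~ (B \subset B') -> y B s = 0 &
      forall s, (forall B', B' \in N -> s \in B' -> B \subset B') ->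
        0 < (y B s : R)].
Proof.
case=> _ faces.
pose form_at B (y : 'R^(R, S)) := [/\ evaluations A y, forall s, 0 <= (y s : R),
  forall s B', B' \in N -> s \in B' -> ~~ (B \subset B') -> y s = 0 &
  forall s, (forall B', B' \in N -> s \in B' -> B \subset B') -> 0 < (y s : R)].
suff /boolp.choice[y yP] : forall B, exists y, form_at B y by exists y.
move=> B.
have sub : [set B' in N | ~~ (B \subset B')] \subset N.
  by apply/subsetP => B'; rewrite inE => /andP[].
have [y [evy y0 ypos]] := matroid_face_evaluation (faces _ sub).
exists y; split=> //.
- move=> s; case: (boolP (s \in cover [set B' in N | ~~ (B \subset B')])).
    by move=> /y0 ->.
  by move=> /ypos/ltW.
- move=> s B' B'N sB' nsub; apply: y0; apply/bigcupP; exists B' => //.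
  by rewrite inE B'N.
- move=> s sN; apply: ypos; apply/bigcupP => -[B']; rewrite inE => /andP[B'N].
  by move=> /negP nsub /(sN _ B'N).
Qed.

(** The masses of the elements of [N] can be prescribed independently on the
    evaluation space: the form attached to [B] in [nested_forms] has no mass on
    the elements of [N] other than those containing [B], and has positive mass
    on [B], so the system is triangular with respect to cardinality. *)
Lemma independent_masses N w : acyclic_nested_set BB A N ->
  exists v, evaluations A v /\ forall B, B \in N -> mass v B = w B.
Proof.
move=> acN; have [nestN _] := acN; have [NBB _ _ _] := nestN.
have [y yP] := nested_forms acN.
have yB B : B \in BB -> mass (y B) B != 0.
  move=> BBB; have [s sB sN] := nested_core BB_building nestN BBB.
  have [_ y_ge0 _ /(_ _ sN) y_gt0] := yP B.
  rewrite gt_eqF // (lt_le_trans y_gt0) // -mass1 mass_sub // sub1set //.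
have y0 B B' : B' \in N -> ~~ (B \subset B') -> mass (y B) B' = 0.
  move=> B'N nsub; rewrite /mass big1 // => s sB'.
  by have [_ _ y0 _] := yP B; apply: (y0 s B').
suff [v [evv vP]] : exists v, evaluations A v /\
    forall B, B \in N -> (#|B| < #|S|.+1)%N -> mass v B = w B.
  by exists v; split=> // B BN; rewrite vP // ltnS max_card.
elim: #|S|.+1 => [|k [v [evv vP]]].
  by exists 0; split=> //; apply: evaluations0.
pose c B := (w B - mass v B) / mass (y B) B.
pose v' := \sum_(B in [pred B in N | #|B| == k]) c B *: y B.
exists (v + 1 *: v'); split.
  apply: evaluations_lin => //; apply: evaluations_sum => B _.
  by case: (yP B).
move=> B' B'N; rewrite ltnS leq_eqVlt massD mul1r mass_sum.
have other B : B \in N -> #|B| == k -> (#|B'| <= k)%N -> B != B' -> mass (y B) B' = 0.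
  move=> BN /eqP cB cB' nBB'; apply: y0 => //; apply: contra nBB' => sub.
  by rewrite eqEcard sub cB.
case/orP => [/eqP cB'|cB'].
  rewrite (bigD1 B') /=; last by rewrite inE B'N cB' /=.
  rewrite big1 => [|B /andP[/andP[/= BN cB] nBB']]; last first.
    by rewrite other ?mulr0 // cB'.
  rewrite addr0 divfK; first by ring.
  by apply: yB; apply: (subsetP NBB).
rewrite big1 ?addr0 ?vP // => B /andP[/= BN cB]; rewrite other ?mulr0 //.
  exact: ltnW.
by apply: contraTneq cB => ->; rewrite neq_ltn cB'.
Qed.

(** Increase slightly and simultaneously the masses of all tight blocks outside
    [N]. *)
Lemma tight_shrink z x N : steep z -> feasible z x ->
  acyclic_nested_set BB A N -> N \subset tight z x ->
  exists x', feasible z x' /\ tight z x' = N.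
Proof.
move=> sz fx [nestN _] sub; have [NBB kN _ _] := nestN.
have acM := tight_acyclic A_acyclic BB_oriented sz fx.
have [v [evv vP]] := independent_masses (fun B => (B \notin N)%:R) acM.
have [evx ge kap] := fx.
pose P := [pred B in BB | B \notin tight z x].
have [|e e0 eP] := @small_step _ _ P (fun B => mass x B - z B) (mass v).
  move=> B /= /andP[BBB]; rewrite inE BBB /= => ne.
  by rewrite subr_gt0 lt_def ne ge.
have tightP B : B \in tight z x -> mass x B = z B by rewrite inE => /andP[_ /eqP].
have big_mass B : B \in BB -> B \notin N -> z B < mass (x + e *: v) B.
  move=> BBB nN; rewrite massD; have [Bt|nt] := boolP (B \in tight z x).
    by rewrite vP // tightP // nN mulr1 ltrDl.
  have := eP B; rewrite /P /= BBB nt => /(_ isT) /=; lra.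
have eq_mass B : B \in N -> mass (x + e *: v) B = z B.
  move=> BN; have Bt := subsetP sub _ BN.
  by rewrite massD vP // tightP // BN mulr0 addr0.
exists (x + e *: v); split.
  split; first exact: evaluations_lin.
    move=> B BBB; have [/eq_mass ->//|nN] := boolP (B \in N).
    exact: ltW (big_mass _ BBB nN).
  by move=> B /(subsetP kN)/eq_mass.
apply/setP => B; rewrite inE; have [BN|nN] := boolP (B \in N).
  by rewrite (subsetP NBB) // eq_mass // eqxx.
have [BBB|//] := boolP (B \in BB); by rewrite gt_eqF // big_mass.
Qed.

Lemma steep_segment z0 z1 (t : R) : steep z0 -> steep z1 -> 0 <= t <= 1 ->
  steep (fun B => z0 B + t * (z1 B - z0 B)).
Proof.
move=> [z0s z0P] [z1s z1P] /andP[t0 t1]; split=> [s|C K CBB C2 KBB tK Kprop].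
  by rewrite z0s z1s subrr mulr0 addr0.
have := z0P C K CBB C2 KBB tK Kprop; have := z1P C K CBB C2 KBB tK Kprop.
rewrite big_split /= -mulr_sumr sumrB.
move: (\sum_(B in K) z0 B) (\sum_(B in K) z1 B) => m0 m1 lt1 lt0.
have : 0 < (1 - t) * (z0 C - (1 + r) * m0) + t * (z1 C - (1 + r) * m1).
  have [t_lt1|t_ge1] := ltP t 1.
    by rewrite ltr_wpDr ?mulr_gt0 ?mulr_ge0 ?subr_gt0 // subr_ge0 ltW.
  by rewrite (_ : t = 1) ?subrr ?mul0r ?add0r ?mul1r ?subr_gt0 //; apply/le_anti/andP.
lra.
Qed.

(** Follow the face given by [N] while the right hand sides move linearly from
    [z0] to [z1], as far as it is nonempty. If this ended before [z1], the tight
    set at the end would be an acyclic nested set by [tight_acyclic], since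
    steepness holds on the whole segment; by [independent_masses] the point can
    then follow the right hand sides of all its tight blocks a little further. *)
Lemma tight_transport z0 z1 N x0 : steep z0 -> steep z1 ->
  acyclic_nested_set BB A N -> feasible z0 x0 -> N \subset tight z0 x0 ->
  exists x1, feasible z1 x1 /\ N \subset tight z1 x1.
Proof.
move=> sz0 sz1 acN fx0 N0; have [[NBB kN _ _] _] := acN.
pose z t B := z0 B + t * (z1 B - z0 B).
pose E (p : 'R^(R, S) * R^o) := evaluations A p.1 /\
  forall B, B \in N -> mass p.1 B = z p.2 B.
pose l (i : option {set S}) (p : 'R^(R, S) * R^o) : R :=
  if i is Some B then (if B \in BB then mass p.1 B - z p.2 B else 0)
  else 1 - p.2.
have line1 (p p' : 'R^(R, S) * R^o) (t : R) :
  (p + t *: (p' - p)).1 = p.1 + t *: (p'.1 - p.1) by [].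
have line2 (p p' : 'R^(R, S) * R^o) (t : R) :
  (p + t *: (p' - p)).2 = (p.2 : R) + t * ((p'.2 : R) - p.2) by [].
(* the largest parameter at which the face given by N is nonempty *)
have [[x t] [[evx xN] lx maxt]] : exists p : 'R^(R, S) * R^o,
    [/\ E p, forall i, 0 <= l i p &
    forall p', E p' -> (forall i, 0 <= l i p') -> (p'.2 : R) <= p.2].
  apply: (@lp_attained _ _ E _ l (fun p => p.2) 1).
  - move=> p p' t [ev pN] [ev' p'N]; split.
      by rewrite line1; apply: evaluations_line.
    move=> B BN; rewrite line1 line2 massD massB pN // p'N // /z; ring.
  - move=> [B|] p p' t; rewrite /l ?line1 ?line2; last by ring.
    case: ifP => _; last by ring.
    rewrite massD massB /z; ring.
  - by move=> p p' t; rewrite line2.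
  - have [ev ge _] := fx0; exists (x0, 0); split.
      split=> //= B /(subsetP N0); rewrite inE /z mul0r addr0.
      by case/andP => _ /eqP.
    move=> [B|] /=; last by rewrite subr0 ler01.
    by case: ifP => // BBB; rewrite /z mul0r addr0 subr_ge0 ge.
  - by move=> p _ /(_ None) /=; rewrite subr_ge0.
have t_le1 : t <= 1 by have := lx None; rewrite /= subr_ge0.
have t_ge0 : 0 <= t.
  apply: (maxt (x0, 0)).
    have [ev ge _] := fx0; split=> //= B /(subsetP N0); rewrite inE /z mul0r addr0.
    by case/andP => _ /eqP.
  have [ev ge _] := fx0; move=> [B|] /=; last by rewrite subr0 ler01.
  by case: ifP => // BBB; rewrite /z mul0r addr0 subr_ge0 ge.
rewrite /= in xN evx.
have fx : feasible (z t) x.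
  split=> // B.
    by move=> BBB; have := lx (Some B); rewrite /= BBB subr_ge0.
  by move=> /(subsetP kN)/xN.
have Nt : N \subset tight (z t) x.
  by apply/subsetP => B BN; rewrite inE (subsetP NBB) //= xN.
have [t1|t_lt1] : t = 1 \/ t < 1 by case: ltgtP t_le1; [right|by []|left].
  exists x; have z1E B : z 1 B = z1 B by rewrite /z; ring.
  split.
    case: fx => ev ge kap; split=> // B BBB; rewrite -z1E -t1; [exact: ge|exact: kap].
  apply/subsetP => B /(subsetP Nt); rewrite !inE => /andP[-> /eqP ->].
  by rewrite t1 z1E eqxx.
exfalso.
have szt : steep (z t) by apply: steep_segment => //; rewrite t_ge0.
have acM := tight_acyclic A_acyclic BB_oriented szt fx.
have [v [evv vP]] := independent_masses (fun B => z1 B - z0 B) acM.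
pose P (i : option {set S}) :=
  if i is Some B then (B \in BB) && (B \notin tight (z t) x) else true.
have [|e e0 eP] := @small_step _ _ P (fun i => l i (x, t))
  (fun i => if i is Some B then mass v B - (z1 B - z0 B) else -1).
  move=> [B|] /=; last by rewrite subr_gt0.
  move=> /andP[BBB]; rewrite inE BBB /= => ne.
  by case: fx => _ ge _; rewrite subr_gt0 lt_def ne ge.
have tightP B : B \in tight (z t) x -> mass x B = z t B.
  by rewrite inE => /andP[_ /eqP].
have stepE B : z (t + e) B = z t B + e * (z1 B - z0 B) by rewrite /z; ring.
have := maxt (x + e *: v, t + e).
suff feas' : E (x + e *: v, t + e) /\ forall i, 0 <= l i (x + e *: v, t + e).
  by case: feas' => H1 H2 /(_ H1 H2) /=; lra.
split.
  split; first exact: evaluations_lin.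
  move=> B BN; rewrite /= massD stepE vP ?xN //.
  exact: (subsetP Nt).
move=> [B|] /=; last by have := eP None isT; rewrite /=; lra.
case: ifP => // BBB; rewrite massD stepE.
have [Bt|nt] := boolP (B \in tight (z t) x).
  by rewrite vP // tightP // subrr.
have := eP (Some B); rewrite /P /= BBB nt => /(_ isT) /=; lra.
Qed.

(** With the right hand sides still free it suffices to find [x] of rapidly growing
    mass. Combine the forms of [nested_forms] with coefficients
    [T ^+ (3 * #|B| + 2)] for the nonsingleton [B] in [N] and a large [T]. The
    value at an element [s] is dominated by the form of the smallest member of
    [N] containing [s]; so every nonsingleton block [B] has mass at least
    [T ^+ (3 * #|B| + 1)], and those in [N] have mass at most
    [T ^+ (3 * #|B| + 3)]. The mass of [x] on [N] and the lower bound elsewhere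
    (zero at singletons) are therefore steep right hand sides, the gap between the exponents of two
    cardinalities leaving one factor [T] for the constants. *)
Lemma tight_start N : acyclic_nested_set BB A N ->
  exists z x, [/\ steep z, feasible z x & N \subset tight z x].
Proof.
move=> acN; have [nestN _] := acN; have [NBB kN _ _] := nestN.
have [y yP] := nested_forms acN.
have y_ge0 B s : 0 <= (y B s : R) by case: (yP B).
(* larger than every constant involved, and than the inverses of the positive
   coordinates of the forms *)
pose T : R := 2 + (1 + r) * #|BB|%:R + \sum_(B in BB) \sum_s (y B s + (y B s : R)^-1).
have r1 := max_circuit_ratio_ge1 A.
have T_sum0 : 0 <= \sum_(B in BB) \sum_s (y B s + (y B s : R)^-1).
  by do 2! (apply: sumr_ge0 => ? _); rewrite addr_ge0 // invr_ge0.
have T_BB0 : 0 <= (1 + r) * #|BB|%:R.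
  by rewrite mulr_ge0 ?ler0n //; lra.
have T2 : 2 <= T by rewrite /T; lra.
have T_BB : (1 + r) * #|BB|%:R < T by rewrite /T; lra.
have T_y : \sum_(B in BB) \sum_s (y B s : R) <= T.
  have : \sum_(B in BB) \sum_s (y B s : R) <=
         \sum_(B in BB) \sum_s (y B s + (y B s : R)^-1).
    by do 2! (apply: ler_sum => ? _); rewrite lerDl invr_ge0.
  rewrite /T; lra.
have T_inv B s : B \in BB -> 0 < (y B s : R) -> 1 <= T * y B s.
  move=> BBB ys; rewrite -ler_pdivrMr // div1r.
  have : (y B s : R)^-1 <= \sum_(B in BB) \sum_s (y B s + (y B s : R)^-1).
    rewrite (bigD1 B) //= (bigD1 s) //=.
    have h1 : 0 <= \sum_(i | i != s) (y B i + (y B i : R)^-1).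
      by apply: sumr_ge0 => ? _; rewrite addr_ge0 // invr_ge0.
    have h2 : 0 <= \sum_(i in BB | i != B) \sum_s (y i s + (y i s : R)^-1).
      by do 2! (apply: sumr_ge0 => ? _); rewrite addr_ge0 // invr_ge0.
    have := y_ge0 B s; lra.
  rewrite /T; lra.
have T0 : 0 < T by lra.
have T1 : 1 <= T by lra.
pose x := \sum_(B in [pred B in N | (2 <= #|B|)%N]) T ^+ (3 * #|B| + 2) *: y B.
have evx : evaluations A x by apply: evaluations_sum => B _; case: (yP B).
have massx C : mass x C =
    \sum_(B in [pred B in N | (2 <= #|B|)%N]) T ^+ (3 * #|B| + 2) * mass (y B) C.
  by rewrite mass_sum.
have x0 s : 0 <= (x s : R).
  rewrite -mass1 massx; apply: sumr_ge0 => B _; rewrite mulr_ge0 //.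
    by rewrite exprn_ge0 // ltW.
  exact: mass_ge0.
have low B : B \in BB -> (2 <= #|B|)%N -> T ^+ (3 * #|B| + 1) <= mass x B.
  move=> BBB B2; have [s sB sN] := nested_core BB_building nestN BBB.
  have [B1 [B1N sB1 B1min]] := nested_smallest BB_building s nestN.
  have BB1 : B \subset B1 by apply: sN.
  have cB : (#|B| <= #|B1|)%N by apply: subset_leq_card.
  have ys : 0 < (y B1 s : R) by case: (yP B1) => _ _ _; apply.
  have h1 : mass x [set s] <= mass x B by apply: mass_sub; rewrite ?sub1set.
  apply: le_trans h1; rewrite massx (bigD1 B1) /=; last first.
    by rewrite inE B1N (leq_trans B2).
  rewrite mass1.
  have h2 : 0 <= \sum_(i in [pred B in N | (2 <= #|B|)%N] | i != B1)
      T ^+ (3 * #|i| + 2) * mass (y i) [set s].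
    by apply: sumr_ge0 => B' _; rewrite mulr_ge0 ?mass_ge0 // exprn_ge0 // ltW.
  apply: (@le_trans _ _ (T ^+ (3 * #|B1| + 1))).
    by rewrite ler_weXn2l // leq_add2r leq_mul2l cB orbT.
  have := T_inv _ _ (subsetP NBB _ B1N) ys.
  have : 0 <= T ^+ (3 * #|B1| + 1) by rewrite exprn_ge0 // ltW.
  rewrite (addnS _ 1) exprS.
  move: h2; set P := T ^+ _; set Q := \sum_(i in _ | _) _; nra.
have above B C : C \in N -> ~~ (B \subset C) -> mass (y B) C = 0.
  move=> CN nsub; rewrite /mass big1 // => s sC.
  by have [_ _ y0 _] := yP B; apply: (y0 s C).
have upp C : C \in N -> mass x C <= T ^+ (3 * #|C| + 3).
  move=> CN; rewrite massx.
  apply: (@le_trans _ _ (T ^+ (3 * #|C| + 2) * \sum_(B in BB) \sum_s (y B s : R))).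
    rewrite mulr_sumr big_mkcond [X in _ <= X]big_mkcond; apply: ler_sum => B _ /=.
    have rhs0 : 0 <= T ^+ (3 * #|C| + 2) * \sum_s (y B s : R).
      by rewrite mulr_ge0 ?sumr_ge0 // exprn_ge0 // ltW.
    case: ifP => [/andP[/= BN B2]|_]; last by case: ifP.
    rewrite (subsetP NBB) //; have [sub|nsub] := boolP (B \subset C).
      apply: ler_pM; rewrite ?exprn_ge0 ?mass_ge0 //; first exact: ltW.
        by rewrite ler_weXn2l // leq_add2r leq_mul2l subset_leq_card ?orbT.
      rewrite massE; apply: ler_sum => s _; by case: ifP.
    by rewrite above // mulr0.
  by rewrite (addnS _ 2) exprSr ler_wpM2l // exprn_ge0 // ltW.
pose z B := if B \in N then mass x B else
  if (2 <= #|B|)%N then T ^+ (3 * #|B| + 1) else 0.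
have z1 s : z [set s] = 0.
  rewrite /z cards1 /=; case: ifP => // sN; rewrite massx big1 // => B.
  move=> /andP[/= BN B2]; rewrite above ?mulr0 //; apply: contraTN B2.
  by move=> /subset_leq_card; rewrite cards1 -ltnNge.
have z_le B : B \in BB -> z B <= T ^+ (3 * #|B| + 3).
  move=> BBB; rewrite /z; case: ifP => [/upp //|_].
  case: ifP => _; last by rewrite exprn_ge0 // ltW.
  by rewrite ler_weXn2l // leq_add2l.
have z_ge B : B \in BB -> (2 <= #|B|)%N -> T ^+ (3 * #|B| + 1) <= z B.
  by move=> BBB B2; rewrite /z B2; case: ifP => // _; apply: low.
exists z, x; split.
- split=> // C K CBB C2 KBB _ Kprop.
  apply: lt_le_trans (z_ge C CBB C2).
  apply: (@le_lt_trans _ _ ((1 + r) * (#|BB|%:R * T ^+ (3 * #|C|)))).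
    rewrite ler_wpM2l //; first by lra.
    apply: (@le_trans _ _ (\sum_(B in K) T ^+ (3 * #|C|))).
      apply: ler_sum => B BK; apply: le_trans (z_le B (subsetP KBB _ BK)) _.
      rewrite ler_weXn2l // -mulnSr leq_mul2l /=.
      exact: proper_card (Kprop _ BK).
    rewrite sumr_const -[X in X <= _]mulr_natl.
    rewrite ler_wpM2r ?exprn_ge0 ?ler_nat //; first exact: ltW.
    exact: subset_leq_card.
  by rewrite mulrA addn1 exprS ltr_pM2r // exprn_gt0.
- split=> // [B BBB|B /(subsetP kN) BN]; last by rewrite /z BN.
  rewrite /z; case: ifP => // _; case: ifP => [|_]; first exact: low.
  exact: mass_ge0.
- by apply/subsetP => B BN; rewrite inE (subsetP NBB) //= /z BN.
Qed.

Lemma tight_realizable z N : steep z -> acyclic_nested_set BB A N ->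
  exists x, feasible z x /\ tight z x = N.
Proof.
move=> sz acN; have [z0 [x0 [sz0 fx0 N0]]] := tight_start acN.
have [x1 [fx1 N1]] := tight_transport sz0 sz acN fx0 N0.
exact: tight_shrink fx1 acN N1.
Qed.

End Realization.

(** * Decomposing a point into points of the simplices *)

Section BlockDecomposition.
Local Open Scope ring_scope.
Variables (R : realType) (S : finType) (BB : {set {set S}}).
Variables (rho : {set S} -> R) (x : 'R^(R, S)).
Hypothesis BB_neq0 : forall B, B \in BB -> B != set0.
Hypothesis rho_ge0 : forall B, B \in BB -> 0 <= rho B.
Hypothesis weight_le : forall U, weight BB rho U <= mass x U.
Hypothesis weight_total : mass x setT = weight BB rho setT.
Implicit Types (B U : {set S}) (p : {ffun {set S} * S -> R^o}).

Let total (P : pred ({set S} * S)) p : R := \sum_(q | P q) (p q : R).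

Let totalD P p p' (t : R) : total P (p + t *: p') = total P p + t * total P p'.
Proof.
rewrite /total mulr_sumr -big_split; apply: eq_bigr => q _ /=.
by rewrite !ffunE.
Qed.

Let totalB P p p' : total P (p' - p) = total P p' - total P p.
Proof. by rewrite -scaleN1r totalD mulN1r. Qed.

Let total_pair (P : {set S} -> pred S) p :
  total (fun q => P q.1 q.2) p = \sum_B \sum_(s | P B s) (p (B, s) : R).
Proof. by rewrite pair_big_dep; apply: eq_bigr => -[]. Qed.

Let supported p := forall B s, ~~ ((B \in BB) && (s \in B)) -> p (B, s) = 0.

Let residue p B : R := rho B - \sum_s (p (B, s) : R).

Let weight_residue p U : supported p ->
  weight BB rho U - total (fun q => q.1 \subset U) p =
  \sum_(B in BB | B \subset U) residue p B.
Proof.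
move=> sp; rewrite sumrB; congr (_ - _).
rewrite (total_pair (fun B _ => B \subset U)) [RHS]big_mkcond.
apply: eq_bigr => B _; case: ifP => [/andP[_ ->] //|].
have [BBB /= ->|nB _] := boolP (B \in BB); first by rewrite big_pred0.
by rewrite big1 // => s _; apply: sp; rewrite (negPf nB).
Qed.

Let slack p U : R := mass x U - total (fun q => q.2 \in U) p -
  (weight BB rho U - total (fun q => q.1 \subset U) p).

(** A value [p (B, s)] is the part of the mass [rho B] given to [s]. The slack of
    [U] compares what [x] can still receive on [U] with what the blocks inside
    [U] still have to give. *)
Let maximal_flow : exists p, [/\ supported p, forall q, 0 <= (p q : R),
  forall B, B \in BB -> 0 <= residue p B, forall U, 0 <= slack p U &
  forall B s (e : R), B \in BB -> s \in B -> 0 < e -> e <= residue p B ->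
    exists U, [/\ s \in U, ~~ (B \subset U) & slack p U < e]].
Proof.
pose l (i : ({set S} * S) + ({set S} + {set S})) p : R :=
  match i with
  | inl q => p q
  | inr (inl B) => if B \in BB then rho B - total (fun q => q.1 == B) p else 0
  | inr (inr U) => slack p U
  end.
have row p B : total (fun q => q.1 == B) p = \sum_s (p (B, s) : R).
  rewrite (total_pair (fun B' _ => B' == B)) (bigD1 B) //= eqxx.
  by rewrite [X in _ + X]big1 ?addr0 // => B' /negPf ->; rewrite big_pred0.
have lP p : supported p -> (forall i, 0 <= l i p) <->
    [/\ forall q, 0 <= (p q : R), forall B, B \in BB -> 0 <= residue p B &
        forall U, 0 <= slack p U].
  move=> sp; split=> [lp|[p0 pB pU]].
    split=> [q|B BBB|U]; first exact: (lp (inl q)).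
      by have := lp (inr (inl B)); rewrite /= BBB row.
    exact: (lp (inr (inr U))).
  move=> [q|[B|U]] /=; [exact: p0| |exact: pU].
  by case: ifP => // BBB; rewrite row pB.
have [|||||p [sp /lP-/(_ sp)[p0 pB pU] maxp]] :=
  @lp_attained R _ supported _ l (total predT) (\sum_(B in BB) rho B).
- move=> p p' t sp sp' B s out; rewrite !ffunE sp // sp' // subr0.
  by rewrite scaler0 addr0.
- move=> [q|[B|U]] p p' t /=; first by rewrite !ffunE.
    case: ifP => _; last by ring.
    rewrite totalD totalB; ring.
  rewrite /slack !totalD !totalB; ring.
- by move=> p p' t; rewrite totalD totalB.
- have s0 : supported 0 by move=> B s _; rewrite ffunE.
  have t0 P : total P 0 = 0 by rewrite /total big1 // => q _; rewrite ffunE.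
  exists 0; split=> //; apply/(lP _ s0); split.
  + by move=> q; rewrite ffunE.
  + by move=> B BBB; rewrite /residue -row t0 subr0 rho_ge0.
  + by move=> U; rewrite /slack !t0 !subr0 subr_ge0.
- move=> p sp /(lP _ sp)[_ pB _].
  rewrite (total_pair (fun _ _ => true)) [X in _ <= X]big_mkcond.
  apply: ler_sum => B _; case: ifP => [BBB|/negbT nB].
    by rewrite -subr_ge0; apply: pB.
  by rewrite big1 // => s _; apply: sp; rewrite (negPf nB).
exists p; split=> // B s e BBB sB e0 eB; apply: contrapT => none.
pose unit_flow : {ffun {set S} * S -> R^o} := [ffun q => (q == (B, s))%:R].
have total_unit P : total P unit_flow = (P (B, s))%:R.
  rewrite /total big_mkcond (bigD1 (B, s)) //= ffunE eqxx big1 ?addr0.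
    by case: (P _).
  by move=> q /negPf nq; rewrite ffunE nq; case: ifP.
pose p' := p + e *: unit_flow.
have sp' : supported p'.
  move=> B' s' out; rewrite !ffunE sp // add0r.
  case: eqP => [[eB' es']|_]; last by rewrite scaler0.
  by rewrite eB' es' BBB sB in out.
have slack' U : slack p' U = slack p U - e * (s \in U)%:R + e * (B \subset U)%:R.
  rewrite /slack !totalD !total_unit /=; ring.
have : total predT p' <= total predT p.
  apply: maxp => //; apply/(lP _ sp'); split.
  - move=> q; rewrite !ffunE addr_ge0 // mulr_ge0 //; first exact: ltW.
  - move=> B' B'BB; rewrite /residue -row totalD total_unit row /=.
    have := pB B' B'BB; rewrite /residue; have [<-|_] := eqVneq B B'.
      by move: eB; rewrite /residue /=; lra.
    by rewrite /=; lra.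
  - move=> U; rewrite slack'; have := pU U.
    have [sub|nsub] := boolP (B \subset U).
      by rewrite (subsetP sub _ sB) /=; lra.
    have [sU|sU] := boolP (s \in U); last by rewrite /=; lra.
    have : ~ (slack p U < e) by move=> lt; apply: none; exists U.
    by move=> /negP; rewrite -leNgt /=; lra.
by rewrite totalD total_unit /=; lra.
Qed.

(** A fractional form of Hall's theorem. Distribute as much of the masses [rho B]
    to the elements of the blocks as possible without making a slack negative.
    If a block [B0] has mass left, each of its elements lies in a set of slack
    zero not containing [B0]. Such sets are closed under union: the slack is
    submodular, and strictly so for two sets not containing [B0] whose union
    does. Hence there is a largest one, and it contains every element of [B0],
    a contradiction. So everything is distributed, and comparison of the totals
    leaves no excess in [x]. *)
Lemma block_decomposition : exists y : {set S} -> 'R^(R, S),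
  [/\ forall B s, B \in BB -> 0 <= (y B s : R),
      forall B s, B \in BB -> s \notin B -> y B s = 0,
      forall B, B \in BB -> mass (y B) setT = rho B &
      x = \sum_(B in BB) y B].
Proof.
have [p [sp p0 pB pU sat]] := maximal_flow.
have slackE U : slack p U = mass x U - total (fun q => q.2 \in U) p -
    \sum_(B in BB | B \subset U) residue p B.
  by rewrite -weight_residue.
have res0 B0 : B0 \in BB -> residue p B0 = 0.
  move=> B0B; apply/eqP; rewrite eq_le pB // andbT leNgt; apply/negP => pos.
  (* sets that block any increase of the share of B0 *)
  pose blocking U := (slack p U == 0) && ~~ (B0 \subset U).
  have tight_at s : s \in B0 -> exists2 U, blocking U & s \in U.
    move=> sB0; pose Q U := (s \in U) && ~~ (B0 \subset U).
    apply: contrapT => none.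
    have [|e e0 eP] := @small_step _ _ Q (slack p) (fun=> -1).
      move=> U /andP[sU nsub]; rewrite lt_def pU andbT.
      apply/negP => sl0; apply: none; exists U => //; by rewrite /blocking sl0.
    have e'0 : 0 < Num.min e (residue p B0) by rewrite lt_min e0.
    have [|U [sU nsub]] := sat B0 s _ B0B sB0 e'0.
      by rewrite ge_min lexx orbT.
    rewrite lt_min => /andP[lt _]; have := eP U; rewrite /Q sU nsub => /(_ isT).
    lra.
  have blockingU U U' : blocking U -> blocking U' -> blocking (U :|: U').
    move=> /andP[/eqP sU nU] /andP[/eqP sU' nU'].
    have modular : total (fun q => q.2 \in U :|: U') p +
          total (fun q => q.2 \in U :&: U') p
        = total (fun q => q.2 \in U) p + total (fun q => q.2 \in U') p.
      rewrite /total !(big_mkcond (fun q => _ \in _)) -!big_split.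
      apply: eq_bigr => q _ /=; rewrite !inE.
      by case: (q.2 \in U); case: (q.2 \in U') => //=; rewrite addrC.
    have super : \sum_(B in BB | B \subset U) residue p B +
        \sum_(B in BB | B \subset U') residue p B +
        (if B0 \subset U :|: U' then residue p B0 else 0) <=
        \sum_(B in BB | B \subset U :|: U') residue p B +
        \sum_(B in BB | B \subset U :&: U') residue p B.
      have term B : B \in BB -> (if B \subset U then residue p B else 0) +
          (if B \subset U' then residue p B else 0) <=
          (if B \subset U :|: U' then residue p B else 0) +
          (if B \subset U :&: U' then residue p B else 0).
        move=> BBB; have := pB B BBB; rewrite subsetI.
        have [h|_] := boolP (B \subset U); have [h'|_] := boolP (B \subset U') => //=;
          rewrite ?(subset_trans h (subsetUl _ _)) ?(subset_trans h' (subsetUr _ _));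
          try case: ifP; lra.
      rewrite !big_mkcondr !(bigD1 B0 B0B) /= subsetI (negPf nU) (negPf nU') /=.
      have : \sum_(B in BB | B != B0) (if B \subset U then residue p B else 0) +
          \sum_(B in BB | B != B0) (if B \subset U' then residue p B else 0) <=
          \sum_(B in BB | B != B0) (if B \subset U :|: U' then residue p B else 0) +
          \sum_(B in BB | B != B0) (if B \subset U :&: U' then residue p B else 0).
        by rewrite -!big_split; apply: ler_sum => B /andP[/term].
      lra.
    have m := massUI x U U'; have h1 := pU (U :|: U'); have h2 := pU (U :&: U').
    rewrite !slackE in sU sU' h1 h2; rewrite /blocking slackE.
    move: super; case: (boolP (B0 \subset U :|: U')) => _ super /=; first by lra.
    rewrite andbT; apply/eqP; lra.
  have block0 : blocking set0.
    rewrite /blocking slackE subset0 BB_neq0 // andbT.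
    rewrite /mass big_set0 /total big_pred0 => [|q]; last by rewrite inE.
    rewrite big_pred0 ?subr0 ?eqxx // => B; rewrite subset0.
    by have [/BB_neq0/negPf ->|] := boolP (B \in BB).
  have [U /maxsetP[bU maxU] _] := maxset_exists block0.
  have [/subsetPn[s sB0 sU]] : ~~ (B0 \subset U) by case/andP: bU.
  have [U' bU' sU'] := tight_at s sB0.
  have := maxU _ (blockingU _ _ bU bU') (subsetUl _ _) => /setP/(_ s).
  by rewrite inE sU' orbT (negPf sU).
exists (fun B => [ffun s => p (B, s)]); split.
- by move=> B s _; rewrite ffunE.
- by move=> B s BBB sB; rewrite ffunE sp // (negPf sB) andbF.
- move=> B BBB; rewrite /mass (eq_bigl predT) => [|s]; last by rewrite inE.
  under eq_bigr do rewrite ffunE.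
  by have := res0 B BBB; rewrite /residue => /eqP; rewrite subr_eq0 => /eqP ->.
have flow_in s : total (fun q => q.2 \in [set s]) p = \sum_(B in BB) (p (B, s) : R).
  rewrite (total_pair (fun _ s' => s' \in [set s])) [RHS]big_mkcond.
  apply: eq_bigr => B _; rewrite big_set1; case: ifP => // /negbT nB.
  by rewrite sp // (negPf nB).
have slack_res U : slack p U = mass x U - total (fun q => q.2 \in U) p.
  by rewrite slackE big1 ?subr0 // => B /andP[/res0].
have excess s : 0 <= (x s : R) - \sum_(B in BB) (p (B, s) : R).
  by have := pU [set s]; rewrite slack_res mass1 flow_in.
have no_excess : \sum_s ((x s : R) - \sum_(B in BB) (p (B, s) : R)) = 0.
  rewrite sumrB exchange_big /=; apply/eqP; rewrite subr_eq0; apply/eqP.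
  transitivity (mass x setT); first by apply: eq_bigl => s; rewrite inE.
  rewrite weight_total /weight; apply: eq_big => [B|B]; first by rewrite subsetT andbT.
  by move=> /andP[BBB _]; apply/eqP; rewrite -subr_eq0 -/(residue p B) res0.
apply/ffunP => s; rewrite sum_ffunE; under eq_bigr do rewrite ffunE.
apply/eqP; rewrite -subr_eq0; apply/eqP.
exact: (psumr_eq0P (fun s _ => excess s) no_excess).
Qed.

End BlockDecomposition.

(** * Inequalities of the nestohedron *)

Section Nestohedra.
Local Open Scope ring_scope.
Variables (R : realType) (S : finType) (BB : {set {set S}}).
Variable rho : {set S} -> R.
Hypothesis BB_building : building_set BB.
Hypothesis rho_ge0 : forall B, B \in BB -> 0 <= rho B.
Implicit Types (B U : {set S}) (x u : 'R^(R, S)).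

Let BB_neq0 := building_neq0 BB_building.
Let BB_set1 := building_set1 BB_building.
Let BB_setU := building_setU BB_building.

Lemma simplexP B u : simplex B u <->
  [/\ forall s, 0 <= (u s : R), forall s, s \notin B -> u s = 0 & mass u setT = 1].
Proof.
split=> [[n [w [p [w0 w1 pB ->]]]]|[u0 uB u1]].
  have coord s : (\sum_i w i *: p i) s = \sum_i w i * (p i s : R).
    by rewrite sum_ffunE; apply: eq_bigr => i _; rewrite ffunE.
  split.
  - move=> s; rewrite coord sumr_ge0 // => i _; rewrite mulr_ge0 //.
    by have [b _ <-] := pB i; rewrite ffunE (ler0n R).
  - move=> s sB; rewrite coord big1 // => i _; have [b /= bB <-] := pB i.
    by rewrite ffunE; case: eqP => [sb|_]; [rewrite sb bB in sB|rewrite mulr0].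
  - rewrite mass_sum -w1; apply: eq_bigr => i _; have [b _ <-] := pB i.
    rewrite massE (bigD1 b) //= inE ffunE eqxx big1 ?addr0 ?mulr1 // => s /negPf sb.
    by rewrite inE ffunE sb.
exists #|B|, (fun i => u (enum_val i)), (fun i => basis_vec R (enum_val i)); split.
- by move=> i.
- rewrite -(big_enum_val (fun s => u s : R)) -u1 /mass [RHS]big_mkcond [LHS]big_mkcond.
  by apply: eq_bigr => s _; rewrite inE; case: ifP => // /negbT /uB.
- by move=> i; exists (enum_val i) => //=; apply: enum_valP.
rewrite -(big_enum_val (fun s => (u s : R) *: basis_vec R s)).
apply/ffunP => s; rewrite sum_ffunE; have [sB|sB] := boolP (s \in B).
  rewrite (bigD1 s) //= !ffunE eqxx big1 ?addr0 => [|s' /andP[_ ns]].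
    exact/esym/mulr1.
  by rewrite !ffunE eq_sym (negPf ns) scaler0.
rewrite uB // big1 // => s' s'B; rewrite !ffunE.
by case: eqP => [ss|_]; [rewrite ss s'B in sB|rewrite scaler0].
Qed.

Lemma nestohedron_sum x : nestohedron BB rho x <-> exists u : {set S} -> 'R^(R, S),
  (forall B, B \in BB -> simplex B (u B)) /\ x = \sum_(B in BB) rho B *: u B.
Proof.
split=> [[y yP <-]|[u [uP ->]]].
  suff /boolp.choice[u uP] : forall B, exists u, B \in BB ->
      simplex B u /\ y B = rho B *: u.
    exists u; split=> [B /uP[]//|]; apply: eq_bigr => B /uP[_ //].
  move=> B; have [/yP[u uB <-]|_] := boolP (B \in BB); first by exists u.
  by exists 0.
by exists (fun B => rho B *: u B) => // B BBB /=; exists (u B) => //; apply: uP.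
Qed.

(** The inequalities for blocks imply those for arbitrary sets, and the equalities
    for maximal blocks fix the total mass, because a set is the disjoint union
    of its components; then [block_decomposition] applies. *)
Lemma nestohedronP x : nestohedron BB rho x <->
  (forall B, B \in BB -> weight BB rho B <= mass x B) /\
  (forall B, B \in kappa BB -> mass x B = weight BB rho B).
Proof.
split=> [/nestohedron_sum[u [uP ->]]|[ge kap]].
  have uge0 B s : B \in BB -> 0 <= (u B s : R) by move=> /uP/simplexP[].
  have uin B U : B \in BB -> B \subset U -> mass (u B) U = 1.
    move=> /uP/simplexP[_ u0 <-] /subsetP sub; rewrite !massE; apply: eq_bigr => s _.
    rewrite inE; case: ifP => // /negbT sU; rewrite u0 //.
    by apply: contra sU => /sub.
  split=> U UBB; rewrite mass_sum /weight big_mkcondr.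
    apply: ler_sum => B BBB; case: ifP => [sub|_]; first by rewrite uin ?mulr1.
    by rewrite mulr_ge0 ?rho_ge0 // mass_ge0 // => s; apply: uge0.
  apply: eq_bigr => B BBB; case: ifP => [sub|nsub]; first by rewrite uin ?mulr1.
  rewrite /mass big1 ?mulr0 // => s sU; have /simplexP[_ + _] := uP B BBB; apply.
  apply: contraFN nsub => sB; move: UBB; rewrite inE => maxU.
  have UUB : U :|: B \in BB.
    apply: BB_setU => //; first exact: maxsetp maxU.
    by apply/set0Pn; exists s; rewrite inE sU.
  by rewrite -(maxsetsup maxU UUB (subsetUl _ _)) subsetUr.
have x_ge0 s : 0 <= (x s : R).
  rewrite -mass1; apply: le_trans (ge _ (BB_set1 s)).
  by apply: sumr_ge0 => B /andP[/rho_ge0].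
have ge_all U : weight BB rho U <= mass x U.
  apply: le_trans (weight_blocks rho_ge0 U) _.
  rewrite -{2}(cover_blocks BB_building U) mass_cover ?trivIset_blocks //.
  by apply: ler_sum => B /blocksP[/ge].
have total : mass x setT = weight BB rho setT.
  apply/eqP; rewrite eq_le ge_all andbT.
  rewrite -{1}(cover_blocks BB_building setT) mass_cover ?trivIset_blocks //.
  rewrite blocks_setT (eq_bigr (weight BB rho)) => [|B /kap //].
  apply: (sum_weight_trivIset BB_building rho_ge0).
    by rewrite -blocks_setT; apply: trivIset_blocks.
  by move=> *; apply: subsetT.
have [y [y0 yB ymass ->]] := block_decomposition BB_neq0 rho_ge0 ge_all total.
apply/nestohedron_sum.
pose u B := if rho B == 0 then if [pick b in B] is Some b then basis_vec R b else 0
            else (rho B)^-1 *: y B.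
exists u; split=> [B BBB|].
  rewrite /u; case: eqP => [_|/eqP rB].
    case: pickP => [b bB|none]; last first.
      by have /set0Pn[b] := BB_neq0 BBB; have := none b; rewrite /= => ->.
    apply/simplexP; split=> [s|s sB|].
    - by rewrite ffunE (ler0n R).
    - by rewrite ffunE; case: eqP => // sb; rewrite sb bB in sB.
    - rewrite massE (bigD1 b) //= inE ffunE eqxx big1 ?addr0 // => s /negPf sb.
      by rewrite inE ffunE sb.
  have r0 : 0 < rho B by rewrite lt_def rB rho_ge0.
  apply/simplexP; split=> [s|s sB|].
  - by rewrite ffunE mulr_ge0 ?y0 // invr_ge0 ltW.
  - by rewrite ffunE yB // scaler0.
  - by rewrite -[_ *: _]add0r massD mass0 add0r ymass // mulVf.
apply: eq_bigr => B BBB; rewrite /u; case: eqP => [rB|/eqP rB]; last first.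
  by rewrite scalerA divff // scale1r.
rewrite rB scale0r; apply/ffunP => s; rewrite [RHS]ffunE.
have := ymass B BBB; rewrite rB /mass => /psumr_eq0P; apply; last by rewrite inE.
by move=> s' _; apply: y0.
Qed.

End Nestohedra.

(** * Faces of the acyclonestohedron *)

Section Acyclonestohedra.
Local Open Scope ring_scope.
Variables (R : realType) (d : nat) (S : finType) (A : S -> 'rV[R]_d).
Variable BB : {set {set S}}.
Hypothesis A_acyclic : acyclic_configuration A.
Hypothesis BB_oriented : oriented_building_set BB A.
Implicit Types (x y v : 'R^(R, S)) (B C : {set S}) (K N X : {set {set S}}).

Let BB_building : building_set BB. Proof. by case: BB_oriented. Qed.
Local Notation r := (max_circuit_ratio A).
Local Notation rho := (rho_acyc BB A).
Local Notation z := (weight BB rho).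
Local Notation tight := (tight BB z).
Local Notation Q := (acyclonestohedron BB A).

Let r_ge1 : 1 <= r. Proof. exact: max_circuit_ratio_ge1. Qed.

Let base : R := #|BB|%:R * r.

Let base_ge1 B : B \in BB -> 1 <= base.
Proof.
move=> BBB; rewrite /base -[X in X <= _]mulr1 ler_pM // ler1n card_gt0.
by apply/set0Pn; exists B.
Qed.

Lemma rho_acyc_ge0 B : B \in BB -> 0 <= rho B.
Proof.
move=> /base_ge1 b1; rewrite /rho_acyc; case: ifP => // _.
by rewrite exprn_ge0 // -/base; lra.
Qed.

(** For disjoint blocks strictly inside [C], the total weight is at most the total
    [Z] of [rho] over all blocks strictly inside [C]. There are fewer than
    [#|BB|] of these, each with [rho] at most [base ^+ #|C|.-1], so [r * Z] is
    less than [#|BB|%:R * r * base ^+ #|C|.-1], which is [rho C], while the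
    weight of [C] is [rho C + Z]. *)
Lemma rho_acyc_steep : steep A BB z.
Proof.
split=> [s|C K CBB C2 KBB tK Kprop].
  rewrite /weight big1 // => B /andP[_ /subset_leq_card]; rewrite cards1 => cB.
  by rewrite /rho_acyc ltnNge cB.
pose Z := \sum_(B in BB | B \proper C) rho B.
have zC : z C = rho C + Z.
  rewrite /weight (bigD1 C) /=; last by rewrite CBB subxx.
  congr (_ + _); apply: eq_bigl => B; rewrite properEneq.
  by case: (B \in BB) => //=; rewrite andbC.
have KZ : \sum_(B in K) z B <= Z.
  apply: (sum_weight_trivIset BB_building rho_acyc_ge0 tK) => B B' BK _ sub.
  exact: sub_proper_trans sub (Kprop B BK).
have r1 := r_ge1; have b1 := base_ge1 CBB.
have b0 : 0 < base by lra.
pose n := #|[pred B in BB | B \proper C]|.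
have nBB : (n < #|BB|)%N.
  apply/proper_card/properP; split.
    by apply/subsetP => B; rewrite inE => /andP[].
  by exists C => //; rewrite inE properxx andbF.
have pos : 0 < base ^+ #|C|.-1 by rewrite exprn_gt0.
have ZC : Z <= n%:R * base ^+ #|C|.-1.
  rewrite mulr_natl -sumr_const; apply: ler_sum => B /andP[BBB BC].
  rewrite /rho_acyc; case: ifP => [B2|_]; last exact: ltW.
  rewrite -/base ler_weXn2l // -ltnS prednK ?proper_card //.
  exact: ltnW.
have rhoC : rho C = r * (#|BB|%:R * base ^+ #|C|.-1).
  rewrite /rho_acyc C2 -/base -[in LHS](prednK (ltnW C2)) exprS /base.
  by rewrite mulrA [r * _]mulrC.
have lt_n : r * (n%:R * base ^+ #|C|.-1) < r * (#|BB|%:R * base ^+ #|C|.-1).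
  by rewrite ltr_pM2l ?ltr_pM2r ?ltr_nat //; lra.
have : r * Z <= r * (n%:R * base ^+ #|C|.-1) by rewrite ler_wpM2l //; lra.
have : (1 + r) * \sum_(B in K) z B <= (1 + r) * Z by rewrite ler_wpM2l //; lra.
rewrite zC rhoC; lra.
Qed.

Lemma acyclonestohedronP x : Q x <-> feasible A BB z x.
Proof.
split=> [[/(nestohedronP BB_building rho_acyc_ge0)[ge kap] ev]|[ev ge kap]] //.
by split=> //; apply/(nestohedronP BB_building rho_acyc_ge0).
Qed.

Definition face_of X : set 'R^(R, S) :=
  [set x | Q x /\ forall B, B \in X -> mass x B = z B]%classic.

Definition mass_defect X x : R := - \sum_(B in X) mass x B.

Lemma mass_defect_is_linear X : scalar (mass_defect X).
Proof.
move=> k x y; rewrite /mass_defect mulrN -opprD mulr_sumr -big_split /=.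
by congr (- _); apply: eq_bigr => B _; rewrite [k *: x + y]addrC massD addrC.
Qed.

HB.instance Definition _ X := GRing.isLinear.Build R 'R^(R, S) R *%R
  (mass_defect X) (mass_defect_is_linear X).

(** The tight set of a point in the relative interior of the face of [N] is [N]
    itself, which makes the face determine [N]. *)
Lemma tight_interior_point N : acyclic_nested_set BB A N ->
  exists x, Q x /\ tight x = N.
Proof.
move=> acN.
have [x [fx tx]] := tight_realizable A_acyclic BB_oriented rho_acyc_steep acN.
by exists x; split=> //; apply/acyclonestohedronP.
Qed.

Lemma face_ofP X x : Q x -> X \subset BB -> face_of X x <-> X \subset tight x.
Proof.
move=> Qx /subsetP XBB; split=> [[_ mX]|/subsetP sub].
  by apply/subsetP => B BX; rewrite inE XBB //= mX.
by split=> // B /sub; rewrite inE => /andP[_ /eqP].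
Qed.

(** The face is exposed by the negative of the sum of the masses of its blocks,
    each of which is bounded below; the bounds are attained simultaneously at
    the point of [tight_interior_point]. *)
Lemma face_of_nested N : acyclic_nested_set BB A N ->
  nonempty_face Q (face_of (N :\: kappa BB)).
Proof.
move=> acN; have [x [Qx tx]] := tight_interior_point acN.
have NBB : N \subset BB by case: acN => -[].
have XBB : N :\: kappa BB \subset BB by apply: subset_trans NBB; apply: subsetDl.
have Fx : face_of (N :\: kappa BB) x by apply/face_ofP; rewrite // tx subsetDl.
split; first by exists x.
set X := N :\: kappa BB in XBB Fx *.
have ge y B : Q y -> B \in X -> z B <= mass y B.
  by move=> /acyclonestohedronP[_ ge _] BX; apply: ge; apply: (subsetP XBB).
exists (mass_defect X); apply/seteqP; split=> y /=.
  move=> [Qy my]; split=> // y' Qy'; rewrite /mass_defect lerN2.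
  by apply: ler_sum => B BX; rewrite my // ge.
move=> [Qy /(_ x Qx)]; rewrite /= /mass_defect lerN2 => le_yx.
split=> // B BX; apply/eqP; rewrite -subr_eq0; apply/eqP.
apply: (@psumr_eq0P _ _ [in X] (fun B => mass y B - z B)) => //.
  by move=> B' B'X; rewrite subr_ge0 ge.
apply/eqP; rewrite eq_le sumr_ge0 => [|B' B'X]; last by rewrite subr_ge0 ge.
rewrite andbT sumrB subr_le0; apply: le_trans le_yx _.
by apply: ler_sum => B' B'X; case: Fx => _ ->.
Qed.

(** Choose a point of the face with as few tight blocks as possible: it plays the
    role of a point in the relative interior. *)
Lemma face_is_face_of F : nonempty_face Q F ->
  exists2 N, acyclic_nested_set BB A N & F = face_of (N :\: kappa BB).
Proof.
case=> -[x0 Fx0] [g Fdef].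
pose P n := `[< exists x, F x /\ #|tight x| = n >].
have exP : exists n, P n by exists #|tight x0|; apply/asboolP; exists x0.
case: (ex_minnP exP) => n /asboolP[x [Fx cx]] minn.
have FP y : F y <-> Q y /\ forall y', Q y' -> g y' <= g y by rewrite Fdef.
have [Qx gx] := (FP x).1 Fx; have fx := (acyclonestohedronP x).1 Qx.
have acN := tight_acyclic A_acyclic BB_oriented rho_acyc_steep fx.
have XBB : tight x :\: kappa BB \subset BB.
  by apply/subsetP => B; rewrite !inE => /andP[_ /andP[]].
have segment y y' (t : R) : g (y + t *: (y' - y)) = g y + t * (g y' - g y).
  by rewrite linearD linearZ linearB.
exists (tight x) => //; apply/seteqP; split=> y.
  (* the midpoint of x and y has only the common tight sets *)
  move=> Fy; have [Qy gy] := (FP y).1 Fy; have fy := (acyclonestohedronP y).1 Qy.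
  apply/face_ofP => //; apply: subset_trans (subsetDl _ _) _.
  have [evx gex kapx] := fx; have [evy gey kapy] := fy.
  pose m := x + 2^-1 *: (y - x).
  have mm B : mass m B = 2^-1 * (mass x B + mass y B).
    by rewrite /m massD massB; field.
  have Qm : Q m.
    apply/acyclonestohedronP; split; first exact: evaluations_line.
      by move=> B BBB; rewrite mm; have := gex B BBB; have := gey B BBB; lra.
    by move=> B Bk; rewrite mm kapx // kapy //; field.
  have Fm : F m.
    apply/FP; split=> // y' /gx; rewrite /m segment.
    by have := gy x Qx; have := gx y Qy; lra.
  have tm B : B \in tight m -> (B \in tight x) && (B \in tight y).
    rewrite !inE mm => /andP[BBB /eqP e]; rewrite BBB /=.
    by have := gex B BBB; have := gey B BBB => h1 h2; apply/andP; split; apply/eqP; lra.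
  have sub : tight m \subset tight x by apply/subsetP => B /tm /andP[].
  have /eqP <- : tight m == tight x.
    by rewrite eqEcard sub cx minn //; apply/asboolP; exists m.
  by apply/subsetP => B /tm /andP[].
(* y is in F because the segment from y to x extends beyond x inside Q *)
move=> FXy; have [Qy mX] := FXy; have [evy gey kapy] := (acyclonestohedronP y).1 Qy.
have [evx gex kapx] := fx.
have [|e e0 eP] := @small_step _ _ [pred B in BB | B \notin tight x]
  (fun B => mass x B - z B) (fun B => - (mass y B - mass x B)).
  move=> B /= /andP[BBB]; rewrite inE BBB /= => ne.
  by rewrite subr_gt0 lt_def ne gex.
pose m := x + (- e) *: (y - x).
have Qm : Q m.
  apply/acyclonestohedronP; split; first exact: evaluations_line.
    move=> B BBB; rewrite massD massB.
    have [Bt|nt] := boolP (B \in tight x).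
      have mxB : mass x B = z B by move: Bt; rewrite inE => /andP[_ /eqP].
      have myB : mass y B = z B.
        have [Bk|nk] := boolP (B \in kappa BB); first exact: kapy.
        by apply: mX; rewrite inE nk.
      by rewrite mxB myB subrr mulr0 addr0.
    by have := eP B; rewrite /= BBB nt => /(_ isT); lra.
  by move=> B Bk; rewrite massD massB kapx // kapy // subrr mulr0 addr0.
apply/FP; split=> // y' /gx le_y'; apply: le_trans le_y' _.
have := gx m Qm; rewrite /m segment => le_m.
by rewrite -(ler_pM2l e0); lra.
Qed.

Lemma face_of_subset N N' : acyclic_nested_set BB A N -> acyclic_nested_set BB A N' ->
  (N :\: kappa BB \subset N' :\: kappa BB) <->
  (face_of (N' :\: kappa BB) `<=` face_of (N :\: kappa BB))%classic.
Proof.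
move=> acN acN'; split=> [/subsetP sub y [Qy my]|sub].
  by split=> // B /sub/my.
have [x [Qx tx]] := tight_interior_point acN'.
have NBB M : acyclic_nested_set BB A M -> M :\: kappa BB \subset BB.
  by case=> -[MBB _ _ _] _; apply: subset_trans MBB; apply: subsetDl.
have : face_of (N :\: kappa BB) x.
  by apply: sub; apply/face_ofP; rewrite ?NBB // tx subsetDl.
move/(face_ofP Qx (NBB N acN)); rewrite tx => /subsetP subN.
apply/subsetP => B BN; have := subN B BN; move: BN.
by rewrite !inE => /andP[-> _] ->.
Qed.

End Acyclonestohedra.

Theorem theorem8p3 (R : realType) (d : nat) (S : finType)
    (A : S -> 'rV[R]_d) (BB : {set {set S}}) :
  acyclic_configuration A ->
  oriented_building_set BB A ->
  poset_isomorphic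
    (acyclic_nested_complex BB A) (fun X Y => X \subset Y)
    (nonempty_face (acyclonestohedron BB A)) (@polar_le R _).
Proof.
move=> A_acyclic BB_oriented.
have order X Y : acyclic_nested_complex BB A X -> acyclic_nested_complex BB A Y ->
    X \subset Y <-> polar_le (face_of A BB X) (face_of A BB Y).
  by move=> [N acN <-] [N' acN' <-]; apply: face_of_subset.
exists (face_of A BB); split; last exact: order.
split.
- by move=> _ /= [N acN <-]; apply: face_of_nested.
- move=> X Y; rewrite !in_setE => cX cY eXY; apply/eqP; rewrite eqEsubset.
  by apply/andP; split; apply/order => //; rewrite /polar_le eXY.
- move=> F /= /(face_is_face_of A_acyclic BB_oriented)[N acN ->].
  by exists (N :\: kappa BB) => //; exists N.
Qed.
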